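(* The set $\{\mathcal{A}_\lambda:\lambda\text{ a partition}\}$ is a basis of $\Lambda$ (as a $\mathbb{Q}(q,t)$-vector space).
   Context: Let $\mathbb{F}=\mathbb{Q}(q,t)$ and $\Lambda$ the ring of symmetric functions over $\mathbb{F}$, with plethystic notation. A partition is a tuple $\lambda_1\ge\cdots\ge\lambda_\ell\ge1$ (the empty partition allowed). Let $\mathscr{P}(k)^+=\mathbb{F}[x_1,\ldots,x_k]\otimes\Lambda[x_{k+1}+x_{k+2}+\cdots]$, $\mathscr{P}(0)^+=\Lambda$, $\mathscr{P}^+_{as}=\bigcup_k\mathscr{P}(k)^+$. For $\nu\in\mathbb{Z}^N_{\ge0}$, $E_\nu\in\mathbb{F}[x_1,\ldots,x_N]$ is the non-symmetric Macdonald polynomial: the unique polynomial $x^\nu+$(Bruhat-lower terms) that is a simultaneous eigenvector of the Cherednik operators $Y^{(N)}_1=\omega_N^{-1}T_{N-1}^{-1}\cdots T_1^{-1}$, $Y^{(N)}_{i+1}=t^{-1}T_iY^{(N)}_iT_i$, where $T_if=s_if+(1-t)x_i\frac{f-s_if}{x_i-x_{i+1}}$ and $\omega_Nf=f(q^{-1}x_N,x_1,\ldots,x_{N-1})$. For a composition $\mu$ of length $n$, $\widetilde{E}_\mu\in\mathscr{P}(n)^+$ denotes the limit of $E_{\mu*0^m}$ as $m\to\infty$ in the sense of Ion–Wu convergence (coefficientwise stabilization in the inverse limit of polynomial rings under $x_{k+1}\mapsto 0$, together with $t$-adic convergence of finitely many scalar coefficients in $\mathbb{F}$). Jing operators: for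 $F\in\Lambda$ and $n\ge0$, $\mathscr{B}_n(F)[X]=\langle z^n\rangle F[X-z^{-1}]\,\mathrm{Exp}[(1-t)zX]$, where $\langle z^n\rangle$ takes the coefficient of $z^n$ and $\mathrm{Exp}[X]=\sum_{k\ge0}h_k[X]$. The operator $\partial^{(k)}_-:\mathscr{P}(k)^+\to\mathscr{P}(k-1)^+$ is the $\mathbb{F}[x_1,\ldots,x_{k-1}]$-linear map with $\partial^{(k)}_-(x_k^nF[x_{k+1}+x_{k+2}+\cdots])=\mathscr{B}_n(F)[x_k+x_{k+1}+\cdots]$; it restricts to the identity on $\mathscr{P}(k-1)^+$. The stable-limit symmetrization $\widetilde{\sigma}:\mathscr{P}^+_{as}\to\Lambda$ is $\widetilde{\sigma}(f)=\partial^{(1)}_-\cdots\partial^{(n)}_-f$ for $f\in\mathscr{P}(n)^+$ (independent of $n$). For a partition $\lambda$, $\mathcal{A}_\lambda:=\widetilde{\sigma}(\widetilde{E}_\lambda)$. *)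

(* Defs.v *)
From HB Require Import structures.
From mathcomp Require Import all_boot all_order all_algebra.
From mathcomp Require Import finmap.
From mathcomp.multinomials Require Import monalg.
From Stdlib Require Import ClassicalEpsilon Relation_Operators.

Set Implicit Arguments.
Unset Strict Implicit.
Unset Printing Implicit Defensive.

Import Order.TTheory GRing.Theory Num.Theory.
Local Open Scope ring_scope.

Definition F : fieldType := {fraction {poly {poly rat}}}.
Definition tt : F := tofrac ('X : {poly {poly rat}}).
Definition qq : F := tofrac ((('X : {poly rat})%:P) : {poly {poly rat}}).

Definition tval_ge (x : F) (N : nat) : Prop :=
  exists n d : {poly {poly rat}},
    d`_0 != 0 /\ x = tofrac n / tofrac d /\ (forall i, (i < N)%N -> n`_i = 0).

Definition tconv (a : nat -> F) (l : F) : Prop :=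
  forall N : nat, exists M : nat, forall m, (M <= m)%N -> tval_ge (a m - l) N.

(* One polynomial ring in countably many variables over F:            *)
(*   inl i  stands for x_{i+1},                                        *)
(*   inr j  stands for the power sum p_{j+1}.                          *)
(* P(k)^+ = F[x_1..x_k] (x) Lambda[x_{k+1}+...] is modelled, using     *)
(* that Lambda_F = F[p_1,p_2,...] (char 0), as the polynomials in     *)
(* x_1..x_k and p_1,p_2,..., where p_j stands for p_j[x_{k+1}+...].   *)
(* F[x_1..x_N] is the subring of polynomials in x_1..x_N only.        *)
Definition Var := (nat + nat)%type.
Definition Pol : comNzRingType := {malg F[{cmonom Var}]}.

Definition xv (i : nat) : Pol := << ucm (inl i : Var) >>.
Definition pv (j : nat) : Pol := << ucm (inr j : Var) >>.
Definition cst (a : F) : Pol := a%:MP.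

Definition subst (S : comNzRingType) (c : F -> S) (img : Var -> S) (f : Pol)
  : S :=
  \sum_(m <- msupp f) c (f@_m) * \prod_(v <- finsupp m) img v ^+ m v.

Definition inPk (k : nat) (f : Pol) : Prop :=
  forall m, m \in msupp f -> forall i : nat, (inl i : Var) \in finsupp m -> (i < k)%N.

Definition inPolN (N : nat) (f : Pol) : Prop :=
  forall m, m \in msupp f ->
    (forall i : nat, (inl i : Var) \in finsupp m -> (i < N)%N) /\
    (forall j : nat, (inr j : Var) \notin finsupp m).

Definition inLambda (f : Pol) : Prop := inPk 0 f.

Definition realize (k N : nat) (f : Pol) : Pol :=
  subst cst (fun v => match v with
                      | inl i => xv i
                      | inr j => \sum_(k <= i < N) xv i ^+ j.+1
                      end) f.

Definition IWconv (n : nat) (fs : nat -> Pol) (f : Pol) : Prop :=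
  exists (r : nat) (g : 'I_r -> Pol) (a : 'I_r -> nat -> F) (al : 'I_r -> F),
    (forall i, inPk n (g i)) /\
    (forall i, tconv (a i) (al i)) /\
    (exists M : nat, forall m, (M <= m)%N ->
        fs m = \sum_(i < r) a i m *: realize n (n + m) (g i)) /\
    f = \sum_(i < r) al i *: g i.

(* h_k in the power-sum basis (Newton: k h_k = sum_{j=1}^k p_j h_{k-j}) *)
Fixpoint hlist (k : nat) : seq Pol :=
  match k with
  | 0 => [:: 1]
  | k'.+1 =>
      let s := hlist k' in
      rcons s ((k'.+1)%:R^-1 *: \sum_(j < k'.+1) pv j * nth 0 s (k' - j))
  end.
Definition hk (k : nat) : Pol := nth 0 (hlist k) k.

Definition pleth1mt (f : Pol) : Pol :=
  subst cst (fun v => match v with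
                      | inl i => xv i
                      | inr j => (1 - tt ^+ j.+1) *: pv j
                      end) f.

(* Exp[(1-t) z X] = sum_k z^k h_k[(1-t)X] *)
Definition hk1mt (k : nat) : Pol := pleth1mt (hk k).

(* F[X - u] as a polynomial in u (u = z^{-1}):  p_j |-> p_j - u^j      *)
Definition pleth_minus_u (f : Pol) : {poly Pol} :=
  subst (fun a => (cst a)%:P)
        (fun v => match v with
                  | inl i => (xv i)%:P
                  | inr j => (pv j)%:P - 'X^(j.+1)
                  end) f.

(* Jing operator: B_n(F) = <z^n> F[X - z^{-1}] Exp[(1-t) z X]          *)
(*              = sum_d [u^d]F[X-u] * h_{n+d}[(1-t)X]                  *)
Definition Jing (n : nat) (f : Pol) : Pol :=
  let G := pleth_minus_u f in
  \sum_(d < size G) G`_d * hk1mt (n + d).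

(* partial_-^{(k)} : P(k)^+ -> P(k-1)^+  (k >= 1), F[x_1..x_{k-1}]-linear, *)
(*   x_k^n F[x_{k+1}+...] |-> B_n(F)[x_k + x_{k+1} + ...].              *)
Definition xpart (k : nat) (m : cmonom Var) : Pol :=
  \prod_(v <- finsupp m)
     match v with inl i => if i == k.-1 then 1 else xv i ^+ m v | inr _ => 1 end.
Definition ppart (m : cmonom Var) : Pol :=
  \prod_(v <- finsupp m) match v with inl _ => 1 | inr j => pv j ^+ m v end.

Definition dminus (k : nat) (f : Pol) : Pol :=
  \sum_(m <- msupp f) f@_m *: (xpart k m * Jing (m (inl k.-1 : Var)) (ppart m)).

Fixpoint sigmaT (n : nat) (f : Pol) : Pol :=
  match n with
  | 0 => f
  | n'.+1 => sigmaT n' (dminus n'.+1 f)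
  end.

(* Non-symmetric Macdonald polynomials in N variables.  Operators     *)
(* are indexed 0-based: s i swaps x_{i+1}, x_{i+2} (i.e. s_{i+1}).     *)
Definition swapx (i : nat) (f : Pol) : Pol :=
  subst cst (fun v => match v with
                      | inl j => if j == i then xv i.+1
                                 else if j == i.+1 then xv i else xv j
                      | inr j => pv j
                      end) f.

(* (f - s_i f) / (x_i - x_{i+1}) : the (exact) quotient *)
Definition ddiff (i : nat) (f : Pol) : Pol :=
  epsilon (inhabits 0) (fun g : Pol => (xv i - xv i.+1) * g = f - swapx i f).

Definition Top (i : nat) (f : Pol) : Pol :=
  swapx i f + (1 - tt) *: (xv i * ddiff i f).

(* T^{-1} = t^{-1} (T + t - 1)   (from the Hecke relation (T-t)(T+1)=0) *)
Definition Tinv (i : nat) (f : Pol) : Pol :=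
  tt^-1 *: (Top i f + (tt - 1) *: f).

Definition omega (N : nat) (f : Pol) : Pol :=
  subst cst (fun v => match v with
                      | inl j => if j == 0%N then qq^-1 *: xv N.-1
                                 else if (j < N)%N then xv j.-1 else xv j
                      | inr j => pv j
                      end) f.
Definition omegainv (N : nat) (f : Pol) : Pol :=
  subst cst (fun v => match v with
                      | inl j => if (j.+1 < N)%N then xv j.+1
                                 else if j == N.-1 then qq *: xv 0
                                 else xv j
                      | inr j => pv j
                      end) f.

Definition Y1 (N : nat) (f : Pol) : Pol :=
  omegainv N (foldl (fun g i => Tinv i g) f (iota 0 N.-1)).

Fixpoint Ych (N i : nat) (f : Pol) : Pol :=
  match i with
  | 0 => Y1 N f
  | i'.+1 => tt^-1 *: Top i' (Ych N i' (Top i' f))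
  end.

Definition partial_sum (s : seq nat) (k : nat) : nat := \sum_(i < k) nth 0 s i.
Definition dom_lt (b a : seq nat) : bool :=
  [&& size b == size a, sumn b == sumn a,
      sort geq b != sort geq a &
      all (fun k => partial_sum (sort geq b) k <= partial_sum (sort geq a) k)%N
          (iota 0 (size a).+1)].
Definition swap_nth (s : seq nat) (i j : nat) : seq nat :=
  set_nth 0 (set_nth 0 s i (nth 0 s j)) j (nth 0 s i).
Definition orbit_step (b a : seq nat) : Prop :=
  exists i j : nat, (i < j < size a)%N /\ (nth 0 a i < nth 0 a j)%N /\
                    b = swap_nth a i j.
Definition bruhat_lt (b a : seq nat) : Prop :=
  dom_lt b a \/ clos_trans _ orbit_step b a.

Definition expvec (N : nat) (m : cmonom Var) : seq nat :=
  [seq m (inl i : Var) | i <- iota 0 N].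
Definition xmono (nu : seq nat) : Pol :=
  \prod_(i < size nu) xv i ^+ nth 0 nu i.

Definition is_nsMac (nu : seq nat) (E : Pol) : Prop :=
  let N := size nu in
  inPolN N E /\
  (forall m, m \in msupp (E - xmono nu) -> bruhat_lt (expvec N m) nu) /\
  E != 0 /\
  (forall i, (i < N)%N -> exists c : F, Ych N i E = c *: E).

Definition is_partition (la : seq nat) : bool :=
  sorted geq la && all (fun x => 0 < x)%N la.

Definition is_basis_Lambda (b : seq nat -> Pol) : Prop :=
  (forall la, is_partition la -> inLambda (b la)) /\
  (forall (S : {fset (seq nat)}) (c : seq nat -> F),
     (forall la, la \in S -> is_partition la) ->
     \sum_(la <- S) c la *: b la = 0 -> forall la, la \in S -> c la = 0) /\
  (forall f, inLambda f ->
     exists (S : {fset (seq nat)}) (c : seq nat -> F),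
       (forall la, la \in S -> is_partition la) /\
       f = \sum_(la <- S) c la *: b la).

(* Main.v *)
(* Write B_n for the Jing operators and Q_nu = B_{nu_1} ... B_{nu_l} 1 for a
   composition nu, and order compositions by N2 nu = sum nu_i^2, which is
   strictly monotone for dominance.  From e_k B_n = B_n e_k + B_{n+1} e_{k-1} one
   gets B_m B_{n+1} - t B_{m+1} B_n + B_n B_{m+1} - t B_{n+1} B_m = 0, so Q_nu is
   a combination of Q_kappa with kappa a partition and N2 kappa <= N2 nu; and
   e_rho is a combination of Q_beta with beta a sum of 0/1 vectors of sizes
   rho_j, just as its monomials are.  Let wt rho be the largest N2 among these.

   Of the Macdonald polynomials only the triangularity is used.  Expand
   E_{la 0^m} in the products x^alpha e_rho[x_{n+1} + ...]: since e_rho has the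
   conjugate of rho as its N2-maximal monomial, every product other than x^la
   that occurs has N2 alpha + wt rho < N2 la, and this passes to the t-adic limit.
   As sigma~ (x^alpha F) = B_alpha F, it follows that A_la = Q_la + (Q_beta with
   N2 beta < N2 la).  By induction on N2 the A_la span, degree by degree, and
   they are free by comparison with the equinumerous free family e_rho. *)
Require Import Defs.
From HB Require Import structures.
From mathcomp Require Import all_boot all_order all_algebra.
From mathcomp Require Import finmap.
From mathcomp.multinomials Require Import monalg.
From mathcomp Require Import ring zify.

Set Implicit Arguments.
Unset Strict Implicit.
Unset Printing Implicit Defensive.

Import Order.TTheory GRing.Theory Num.Theory.
Local Open Scope ring_scope.

(* Unfolding the concrete field F makes unification diverge. *)
Local Opaque F.

(* The default [done] starts with [trivial], which ignores opacity. *)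
Ltac done ::=
  first [ reflexivity
  | trivial; hnf; intros; solve
    [ do ![solve [trivial | apply: sym_equal; trivial]
          | discriminate | contradiction | split]
    | match goal with H : ~ _ |- _ => solve [case H; trivial] end ] ].

(** Identities between generating functions are reduced to Newton recursions: over a torsion-free
    ring a series with constant term 1 is determined by its logarithmic derivative, and the
    substitution p_j |-> p_j - u^j changes that derivative by an explicit geometric series. The
    number N2 is preferred to dominance because it measures straightening, Pieri products and Bruhat
    descent alike, and makes sense for unsorted compositions of any length. The e_rho are preferred
    to power sums because their monomial expansions have nonnegative integer coefficients and, for
    distinct partitions rho, distinct sorted N2-maximal exponents; so coefficients in the products
    x^alpha e_rho can be controlled from finitely many variables. A limit in the sense of Ion and Wu
    comes with arbitrary elements g_i and convergent scalars. What passes to the limit is a linear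
    equation between these scalars whose coefficients do not depend on m, and the triangularity is
    cast in that form. *)

Section Subst.
Context (S : comNzRingType) (c : {rmorphism F -> S}) (img : Var -> S).

Definition mev (m : cmonom Var) : S := \prod_(v <- finsupp m) img v ^+ m v.

Lemma mevEw (d : {fset Var}) (m : cmonom Var) :
  (finsupp m `<=` d)%fset -> mev m = \prod_(v <- d) img v ^+ m v.
Proof.
move=> le; rewrite /mev [RHS](big_fsetID _ (mem (finsupp m))) /=.
rewrite [X in _ = _ * X]big1_fset ?mulr1 => [|v].
  by apply: eq_fbigl => v; rewrite !inE /= andb_idl // => /(fsubsetP le).
by rewrite !inE /= => /andP[_ /fsfun_dflt ->].
Qed.

Lemma mev_mmorph : mmorphism mev.
Proof.
split=> [m1 m2|]; last by rewrite /mev mdom1 big_seq_fset0.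
rewrite {1}/mev mdomD; set d := (_ `|` _)%fset.
rewrite (@mevEw d m1) ?fsubsetUl // (@mevEw d m2) ?fsubsetUr // -big_split /=.
by apply: eq_bigr => v _; rewrite cmM exprD.
Qed.

HB.instance Definition _ :=
  isMultiplicative.Build (cmonom Var) S mev mev_mmorph.

Definition sb : {rmorphism Pol -> S} := mmap c mev.

Lemma sb_mono m : sb << m >> = mev m.
Proof. transitivity (c 1 * mev m); [exact: mmapU | by rewrite rmorph1 mul1r]. Qed.

Lemma sb_var v : sb << ucm v >> = img v.
Proof. by rewrite sb_mono /mev mdomU big_seq_fset1 cmUU. Qed.

Lemma sb_xv i : sb (xv i) = img (inl i).
Proof. exact: sb_var. Qed.

Lemma sb_pv i : sb (pv i) = img (inr i).
Proof. exact: sb_var. Qed.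

Lemma sbC a : sb (cst a) = c a.
Proof. exact: mmapC. Qed.

End Subst.

(** Scalars are made to act through multiplication by [cst a], so that ring morphisms and ring
    identities apply to them. *)
Lemma Pol_scale (a : F) (f : Pol) : a *: f = cst a * f.
Proof. by rewrite mul_malgC. Qed.

Definition cstM : {rmorphism F -> Pol} := @malgC (cmonom Var) F.

Lemma cstME a : cst a = cstM a. Proof. by []. Qed.

Lemma monoM (m1 m2 : cmonom Var) : << m1 >> * << m2 >> = << mulcm m1 m2 >> :> Pol.
Proof. by rewrite malgM_def fgmulUU mulr1. Qed.

Lemma monoX v n : exists2 M : cmonom Var,
  (<< ucm v >> : Pol) ^+ n = << M >> & forall u, M u = (n * (v == u))%N.
Proof.
elim: n => [|n [M eM hM]].
  by exists (onecm _) => // u; rewrite onecmE mul0n.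
exists (mulcm (ucm v) M) => [|u]; first by rewrite exprS eM monoM.
by rewrite mulcmE ucmE hM mulSn.
Qed.

Lemma mono_prod (r : seq Var) (e : Var -> nat) : exists2 M : cmonom Var,
  \prod_(v <- r) (<< ucm v >> : Pol) ^+ e v = << M >> &
  forall u, M u = (\sum_(v <- r) e v * (v == u))%N.
Proof.
elim: r => [|v r [M eM hM]].
  by exists (onecm _) => [|u]; rewrite big_nil // onecmE.
have [M' eM' hM'] := monoX v (e v).
exists (mulcm M' M) => [|u]; first by rewrite big_cons eM eM' monoM.
by rewrite mulcmE hM hM' big_cons.
Qed.

Lemma mono_fold (m : cmonom Var) :
  << m >> = \prod_(v <- finsupp m) (<< ucm v >> : Pol) ^+ m v.
Proof.
have [M -> hM] := mono_prod (finsupp m) m.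
congr (<< _ >>); apply/eqP/cmP => u; rewrite hM.
have [um|um] := boolP (u \in finsupp m).
  rewrite (big_fsetD1 u) //= eqxx muln1 big1_fset ?addn0 // => v.
  by rewrite !inE => /andP[/negPf-> _] _; rewrite muln0.
rewrite fsfun_dflt // big1_fset // => v vm _.
by case: eqP um => [<-|]; rewrite ?vm ?muln0.
Qed.

(** * Characteristic zero and the factors 1 - t^k *)

Definition torsionfree (R : comNzRingType) :=
  forall (f : R) k, f *+ k.+1 = 0 -> f = 0.

Local Transparent F.
Lemma tf_F : torsionfree F.
Proof.
move=> f k /eqP; rewrite -mulr_natr mulf_eq0 => /orP[/eqP //|].
suff -> : (k.+1%:R == 0 :> F) = false by [].
rewrite -(rmorph_nat (@tofrac {poly {poly rat}})) tofrac_eq0.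
by rewrite -polyC_natr polyC_eq0 -polyC_natr polyC_eq0 pnatr_eq0.
Qed.

(** The constant term in t is 1. This is the factor by which B_1 sends e_n to e_{n+1}; inverting it
    recovers e_j from B_1^j 1. *)
Lemma one_sub_tt_neq0 n : 1 - tt ^+ n.+1 != 0.
Proof.
have -> : 1 - tt ^+ n.+1 = tofrac (1 - 'X^(n.+1) : {poly {poly rat}}).
  by rewrite /tt (rmorphB (@tofrac _)) rmorphXn rmorph1.
rewrite tofrac_eq0; apply/eqP => /(congr1 (fun p : {poly {poly rat}} => p`_0)).
by rewrite coefB coef1 coefXn coef0 subr0; apply/eqP; exact: oner_neq0.
Qed.

Local Opaque F.
Lemma natF_neq0 k : k.+1%:R != 0 :> F.
Proof. by apply/eqP => h; have /eqP := @tf_F 1 k h; rewrite oner_eq0. Qed.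

Lemma tf_Pol : torsionfree Pol.
Proof.
move=> f k h; apply/malgP => m; rewrite mcoeff0; apply: (@tf_F _ k).
by rewrite -mcoeffMn h mcoeff0.
Qed.

(** * Newton recursions *)

(* [newton c a] says that sum_k a_k z^k = exp (sum_j c_j z^(j+1) / (j+1)). *)
Section Newton.
Context (R : comNzRingType).
Implicit Types a b c d : nat -> R.

Definition newton c a := a 0 = 1 /\
  forall k, a k.+1 *+ k.+1 = \sum_(j < k.+1) c j * a (k - j)%N.

Lemma newton_ext c d a : c =1 d -> newton c a -> newton d a.
Proof.
move=> cd [a0 aS]; split=> // k; rewrite aS.
by apply: eq_bigr => j _; rewrite cd.
Qed.

Lemma newton_uniq c a b : torsionfree R -> newton c a -> newton c b -> a =1 b.
Proof.
move=> tf [a0 aS] [b0 bS] k; elim/ltn_ind: k => -[|k] IH; first by rewrite a0 b0.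
apply/eqP; rewrite -subr_eq0; apply/eqP/(tf _ k).
rewrite mulrnBl aS bS -sumrB big1 // => j _.
by rewrite IH ?subrr // ltnS leq_subr.
Qed.

Lemma newton_scale c a w :
  newton c a -> newton (fun j => w ^+ j.+1 * c j) (fun k => w ^+ k * a k).
Proof.
move=> [a0 aS]; split=> [|k]; first by rewrite a0 expr0 mulr1.
rewrite -mulrnAr aS mulr_sumr; apply: eq_bigr => -[j jk] _ /=.
have -> : w ^+ k.+1 = w ^+ j.+1 * w ^+ (k - j) by rewrite -exprD addSn subnKC.
by rewrite -!mulrA; congr (_ * _); rewrite mulrCA.
Qed.

Definition conv a b k := \sum_(i < k.+1) a i * b (k - i)%N.

Lemma newton_conv c d a b : newton c a -> newton d b ->
  newton (fun j => c j + d j) (conv a b).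
Proof.
move=> na nb; split=> [|k]; first by rewrite /conv big_ord1 na.1 nb.1 mulr1.
pose P f : {poly R} := \poly_(i < k.+2) f i.
have PE f i : (i < k.+2)%N -> (P f)`_i = f i by move=> ik; rewrite coef_poly ik.
have convE u v i : (i < k.+2)%N -> (P u * P v)`_i = conv u v i.
  move=> ik; rewrite coefM; apply: eq_bigr => -[j ji] _ /=.
  by rewrite !PE //; lia.
have derE u f i : newton u f -> (i < k.+1)%N -> (P f)^`()`_i = (P u * P f)`_i.
  move=> [_ fS] ik; rewrite coef_deriv PE ?ltnS // fS convE //; lia.
have prodE (p q r : {poly R}) :
    (forall i, (i < k.+1)%N -> p`_i = q`_i) -> (p * r)`_k = (q * r)`_k.
  move=> pq; rewrite !coefM; apply: eq_bigr => -[j jk] _ /=; by rewrite pq.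
rewrite -convE // -coef_deriv derivM coefD (prodE (P a)^`() (P c * P a)); last first.
  by move=> i; exact: derE.
rewrite [P a * _]mulrC (prodE (P b)^`() (P d * P b)); last by move=> i; exact: derE.
rewrite -coefD.
have -> : P c * P a * P b + P d * P b * P a = (P c + P d) * (P a * P b) by ring.
rewrite coefM.
apply: eq_bigr => -[j jk] _ /=; rewrite coefD !PE ?convE //; lia.
Qed.

Definition lin w k : R := match k with 0 => 1 | 1 => w | _ => 0 end.

(** The left-hand data are the coefficients of log (1 + w z); multiplying a series by 1 + w z
    adjoins one variable w to an alphabet. *)
Lemma newton_lin w : newton (fun j => (-1) ^+ j * w ^+ j.+1) (lin w).
Proof.
split=> // -[|k]; first by rewrite big_ord1 mul1r mulr1.
rewrite mul0rn 2!big_ord_recr /= big1 ?add0r => [|[j jk] _].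
  rewrite subSnn subSS subnn /= mulr1 !exprS; ring.
have -> : (k.+1 - Ordinal jk = (k - j).-1.+2)%N by move: (jk) => /= ?; lia.
by rewrite mulr0.
Qed.

Definition shift a k := if k is k'.+1 then a k' else 0.

Lemma conv_lin a w k : conv a (lin w) k = a k + w * shift a k.
Proof.
case: k => [|k]; rewrite /conv ?big_ord1 /= ?mulr1 ?mulr0 ?addr0 //.
rewrite 2!big_ord_recr /= big1 ?add0r => [|[j jk] _].
  by rewrite subSnn subSS subnn /= mulr1 addrC mulrC.
have -> : (k.+1 - Ordinal jk = (k - j).-1.+2)%N by move: (jk) => /= ?; lia.
by rewrite mulr0.
Qed.

Lemma newton_addlin c a w : newton c a ->
  newton (fun j => c j + (-1) ^+ j * w ^+ j.+1) (fun k => a k + w * shift a k).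
Proof.
move=> /newton_conv /(_ (newton_lin w)) [a0 aS]; split=> [|k].
  by rewrite -conv_lin.
by rewrite -conv_lin aS; apply: eq_bigr => j _; rewrite conv_lin.
Qed.

End Newton.

Lemma newton_rmorph (R S : comNzRingType) (f : {rmorphism R -> S}) c a :
  newton c a -> newton (f \o c) (f \o a).
Proof.
move=> [a0 aS]; split=> [|k] /=; first by rewrite a0 rmorph1.
rewrite -rmorphMn aS rmorph_sum; apply: eq_bigr => j _; exact: rmorphM.
Qed.

Lemma size_hlist k : size (hlist k) = k.+1.
Proof. by elim: k => //= k IH; rewrite size_rcons IH. Qed.

Lemma nth_hlist k n : (n <= k)%N -> nth 0 (hlist k) n = hk n.
Proof.
elim: k => [|k IH]; first by case: n.
rewrite leq_eqVlt => /orP[/eqP -> //|nk].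
by rewrite /= nth_rcons size_hlist nk IH.
Qed.

Lemma newton_hk : newton pv hk.
Proof.
split=> // k; rewrite /hk /= nth_rcons size_hlist ltnn eqxx.
rewrite -scaler_nat scalerA mulfV ?natF_neq0 // scale1r.
by apply: eq_bigr => -[j jk] _ /=; rewrite nth_hlist ?leq_subr.
Qed.

(** * Jing operators *)

(* Abstractly: phi is F |-> F[X - u] with u = 'X, and q_k = h_k[(1-t)X]. *)
Section JingAlgebra.
Context (P : comNzRingType) (T : P) (p e q : nat -> P).
Context (phi : {rmorphism P -> {poly P}}).
Hypothesis tfP : torsionfree P.
Hypothesis newton_e : newton (fun j => (-1) ^+ j * p j) e.
Hypothesis newton_q : newton (fun j => (1 - T ^+ j.+1) * p j) q.
Hypothesis phiT : phi T = T%:P.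
Hypothesis phi_p : forall j, phi (p j) = (p j)%:P - 'X^(j.+1).

Let e0 : e 0 = 1. Proof. exact: newton_e.1. Qed.
Let q0 : q 0 = 1. Proof. exact: newton_q.1. Qed.

Let tf_poly : torsionfree {poly P}.
Proof.
move=> f k h; apply/polyP => i; rewrite coef0; apply: (tfP (k := k)).
by rewrite -coefMn h coef0.
Qed.

(** The alphabet X is X - u together with the variable u, so the generating series of the e_k[X] is
    that of the e_k[X - u] times 1 + u z. *)
Lemma phi_e k : phi (e k) + 'X * shift (phi \o e) k = (e k)%:P.
Proof.
have L : newton (fun j => ((-1) ^+ j * p j)%:P)
    (fun k => phi (e k) + 'X * shift (phi \o e) k).
  apply: newton_ext (newton_addlin 'X (newton_rmorph phi newton_e)) => j /=.
  by rewrite rmorphM rmorphXn rmorphN1 phi_p polyCM polyC_exp polyCN mulrBr addrNK.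
exact: (newton_uniq tf_poly L (newton_rmorph (@polyC P) newton_e) k).
Qed.

(** Exp[(1-t)z(X-u)] is Exp[(1-t)zX] times (1 - uz)/(1 - tuz). The denominator is multiplied out so
    that only polynomials in u occur. *)
Lemma phi_q k : phi (q k) - T%:P * 'X * shift (phi \o q) k
  = (q k)%:P - 'X * shift (polyC \o q) k.
Proof.
pose c j : {poly P} := ((1 - T ^+ j.+1) * p j)%:P - 'X^(j.+1).
have sgn j (w : {poly P}) : (-1) ^+ j * (- w) ^+ j.+1 = - w ^+ j.+1.
  by rewrite (exprNn w) mulrA -exprD addnS -signr_odd oddS oddD addbb expr1 mulN1r.
have L : newton c (fun k => phi (q k) + - (T%:P * 'X) * shift (phi \o q) k).
  apply: newton_ext (newton_addlin _ (newton_rmorph phi newton_q)) => j.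
  rewrite sgn /c /= rmorphM rmorphB rmorphXn rmorph1 phiT phi_p.
  rewrite polyCM polyCB polyC1 polyC_exp exprMn; ring.
have R : newton c (fun k => (q k)%:P + - 'X * shift (polyC \o q) k).
  apply: newton_ext (newton_addlin _ (newton_rmorph (@polyC P) newton_q)) => j.
  by rewrite sgn.
by have := newton_uniq tf_poly L R k; rewrite !mulNr.
Qed.

(** The functional taking G(u) to the coefficient of z^n in G(1/z) sum_k q_k z^k. Multiplying G by u
    raises n by one, which is the source of every commutation rule below. *)
Definition jing_sum n (G : {poly P}) : P := \sum_(d < size G) G`_d * q (n + d).

Lemma jing_sumEw n (G : {poly P}) K : (size G <= K)%N ->
  jing_sum n G = \sum_(d < K) G`_d * q (n + d).
Proof.
move=> GK; rewrite /jing_sum (big_ord_widen K (fun d => G`_d * q (n + d))) //.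
rewrite big_mkcond; apply: eq_bigr => d _ /=.
by case: ltnP => // h; rewrite nth_default // mul0r.
Qed.

Lemma jing_sumD n (G H : {poly P}) :
  jing_sum n (G + H) = jing_sum n G + jing_sum n H.
Proof.
have h1 := leq_maxl (size G) (size H); have h2 := leq_maxr (size G) (size H).
rewrite (jing_sumEw _ h1) (jing_sumEw _ h2) (jing_sumEw _ (size_polyD G H)).
by rewrite -big_split; apply: eq_bigr => d _; rewrite coefD mulrDl.
Qed.

Lemma jing_sumC n c (G : {poly P}) : jing_sum n (c%:P * G) = c * jing_sum n G.
Proof.
rewrite mul_polyC (jing_sumEw _ (size_scale_leq _ _)) /jing_sum mulr_sumr.
by apply: eq_bigr => d _; rewrite coefZ mulrA.
Qed.

Lemma jing_sumX n (G : {poly P}) : jing_sum n ('X * G) = jing_sum n.+1 G.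
Proof.
rewrite (@jing_sumEw _ _ (size G).+1); last first.
  rewrite mulrC (leq_trans (size_polyMleq _ _)) // size_polyX; lia.
rewrite big_ord_recl coefXM mul0r add0r; apply: eq_bigr => d _.
by rewrite coefXM /= /bump addSnnS.
Qed.

Lemma jing_sumP n c : jing_sum n c%:P = c * q n.
Proof.
rewrite (@jing_sumEw _ _ 1) ?size_polyC ?leq_b1 //.
by rewrite big_ord1 coefC addn0.
Qed.

Definition jing n f := jing_sum n (phi f).

Lemma jingD n f g : jing n (f + g) = jing n f + jing n g.
Proof. by rewrite /jing rmorphD jing_sumD. Qed.

Lemma jing0 n : jing n 0 = 0.
Proof. by apply: (addrI (jing n 0)); rewrite -jingD !addr0. Qed.

Lemma jing1 n : jing n 1 = q n.
Proof. by rewrite /jing rmorph1 -polyC1 jing_sumP mul1r. Qed.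

Lemma jingZ n c f : phi c = c%:P -> jing n (c * f) = c * jing n f.
Proof. by move=> phic; rewrite /jing rmorphM phic jing_sumC. Qed.

Lemma jing_elem k n f :
  e k * jing n f = jing n (e k * f) + jing n.+1 (shift e k * f).
Proof.
rewrite /jing -jing_sumC -phi_e mulrDl jing_sumD rmorphM; congr (_ + _).
rewrite -mulrA jing_sumX rmorphM; congr (jing_sum _ (_ * _)).
by case: k => [|k] //=; rewrite rmorph0.
Qed.

(** Apply the functional to [phi_q] with its negative terms moved across. The result is B_m B_n 1 -
    t B_{m+1} B_{n-1} 1 in terms of products of q's. *)
Lemma jing_q m n : jing m (q n) - T * jing m.+1 (shift q n) =
  q n * q m - shift q n * q m.+1.
Proof.
have E : phi (q n) + 'X * ((shift q n)%:P) =
    (q n)%:P + T%:P * ('X * phi (shift q n)).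
  have := phi_q n; case: n => [|n] /=; rewrite ?rmorph0 ?polyC0 ?mulr0 ?subr0 ?addr0 //.
  move/eqP; rewrite subr_eq => /eqP ->; ring.
move/(congr1 (jing_sum m)): E.
rewrite !jing_sumD jing_sumC !jing_sumX !jing_sumP /jing => E.
apply/eqP; rewrite subr_eq addrAC -E; apply/eqP; ring.
Qed.

Lemma jing_e n k : jing n (e k) =
  \sum_(i < k.+1) (-1) ^+ i * (e (k - i)%N * q (n + i)).
Proof.
elim: k n => [|k IH] n; first by rewrite big_ord1 e0 jing1 addn0 !mul1r.
have := jing_elem k.+1 n 1; rewrite !mulr1 jing1 /= => /eqP.
rewrite -subr_eq => /eqP <-; rewrite IH [RHS]big_ord_recl mul1r addn0 subn0.
congr (_ + _); rewrite -sumrN; apply: eq_bigr => i _.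
by rewrite exprS mulN1r mulNr /bump subSS addnS.
Qed.

(** With E and Q the generating series of e and q, this is E(z) Q(-z) = E(tz). *)
Lemma elem_q k : \sum_(i < k.+1) (-1) ^+ i * (e (k - i)%N * q i) = T ^+ k * e k.
Proof.
pose c j := T ^+ j.+1 * ((-1) ^+ j * p j).
transitivity (conv (fun k => (-1) ^+ k * q k) e k).
  by apply: eq_bigr => i _; rewrite -mulrA; congr (_ * _); rewrite mulrC.
have L : newton c (conv (fun k => (-1) ^+ k * q k) e).
  apply: newton_ext (newton_conv (newton_scale (-1) newton_q) newton_e) => j.
  rewrite /c (exprS (-1)); ring.
exact: (newton_uniq tfP L (newton_scale T newton_e) k).
Qed.

Lemma q_rec (s w : nat -> P) :
  (forall i, s i = (-1) ^+ i) -> (forall i, w i = T ^+ i) -> forall n,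
  q n = s n * (w n * e n - \sum_(i < n) s i * (e (n - i)%N * q i)).
Proof.
move=> hs hw n; under eq_bigr do rewrite hs.
rewrite hs hw -elem_q big_ord_recr /= subnn e0 mul1r addrAC subrr add0r.
by rewrite mulrA -expr2 sqrr_sign mul1r.
Qed.

(** By [jing_e], the left side is minus the alternating sum of [elem_q] at k + 1 without its term i
    = 0. *)
Lemma jing1_elem k : jing 1 (e k) = (1 - T ^+ k.+1) * e k.+1.
Proof.
rewrite jing_e mulrBl mul1r -elem_q [X in _ - X]big_ord_recl mul1r subn0 q0 mulr1.
rewrite opprD addNKr -sumrN; apply: eq_bigr => i _.
by rewrite /bump subSS exprS mulN1r mulNr opprK.
Qed.

Definition jrel m n f := jing m (jing n.+1 f) - T * jing m.+1 (jing n f)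
  + jing n (jing m.+1 f) - T * jing n.+1 (jing m f).

(** By [jing_q] each half of the relation equals q_{n+1} q_m - q_n q_{m+1} or the same with m and n
    exchanged, which is its negative. *)
Lemma jrel1 m n : jrel m n 1 = 0.
Proof.
rewrite /jrel !jing1 (jing_q m n.+1) -addrA (jing_q n m.+1) /=; ring.
Qed.

Lemma jrelD m n f g : jrel m n (f + g) = jrel m n f + jrel m n g.
Proof. rewrite /jrel !jingD; ring. Qed.

Lemma jrelZ m n c f : phi c = c%:P -> jrel m n (c * f) = c * jrel m n f.
Proof. move=> phic; rewrite /jrel !(jingZ _ _ phic); ring. Qed.

Lemma jrel0 m n : jrel m n 0 = 0.
Proof. by rewrite /jrel !jing0 !mulr0 !subr0 addr0. Qed.

(** Moving e_k through two Jing operators expresses e_k R_{m,n} as R_{m,n} e_k + (R_{m,n+1} +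
    R_{m+1,n}) e_{k-1} + R_{m+1,n+1} e_{k-2}, where R is [jrel]. So vanishing at f spreads to e_k f
    by induction on k. *)
Lemma jrel_elem f : (forall m n, jrel m n f = 0) ->
  forall k m n, jrel m n (e k * f) = 0.
Proof.
move=> h; elim/ltn_ind => -[|k] IH m n; first by rewrite e0 mul1r.
have ee a b : e k.+1 * jing a (jing b f) =
    jing a (jing b (e k.+1 * f)) + jing a (jing b.+1 (e k * f)) +
    (jing a.+1 (jing b (e k * f)) + jing a.+1 (jing b.+1 (shift e k * f))).
  by rewrite jing_elem jing_elem jingD /= jing_elem jingD.
have sh a b : jrel a b (shift e k * f) = 0.
  by case: k IH {ee} => [|k] IH /=; rewrite ?mul0r ?jrel0 ?IH.
have /eqP : e k.+1 * jrel m n f = jrel m n (e k.+1 * f) +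
   (jrel m n.+1 (e k * f) + jrel m.+1 n (e k * f)) +
   jrel m.+1 n.+1 (shift e k * f).
  have -> : e k.+1 * jrel m n f = e k.+1 * jing m (jing n.+1 f)
      - T * (e k.+1 * jing m.+1 (jing n f)) + e k.+1 * jing n (jing m.+1 f)
      - T * (e k.+1 * jing n.+1 (jing m f)) by rewrite /jrel; ring.
  rewrite !ee /jrel; ring.
by rewrite h mulr0 sh !(IH k (ltnSn k)) !addr0 eq_sym => /eqP.
Qed.

End JingAlgebra.

(** * The Jing operators on the concrete ring *)

Definition signM : {rmorphism Pol -> Pol} :=
  sb cstM (fun v => match v with
                    | inl i => xv i
                    | inr j => (-1) ^+ j * pv j
                    end).

(** [signM] is the involution of Lambda exchanging h_k and e_k; since [pv j] stands for p_{j+1}, its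
    sign is (-1)^j. *)
Definition elem k : Pol := signM (hk k).

Lemma newton_elem : newton (fun j => (-1) ^+ j * pv j) elem.
Proof.
apply: newton_ext (newton_rmorph signM newton_hk) => j /=.
by rewrite /signM sb_pv.
Qed.

Lemma elem0 : elem 0 = 1. Proof. exact: newton_elem.1. Qed.

Lemma cst1 : cst 1 = 1. Proof. by rewrite cstME (rmorph1 cstM). Qed.
Lemma cst0 : cst 0 = 0. Proof. by rewrite cstME (rmorph0 cstM). Qed.
Lemma cst_mul a b : cst (a * b) = cst a * cst b.
Proof. by rewrite !cstME (rmorphM cstM). Qed.
Lemma cst_opp a : cst (- a) = - cst a.
Proof. by rewrite !cstME (rmorphN cstM). Qed.
Lemma cst_exp a n : cst (a ^+ n) = cst a ^+ n.
Proof. by rewrite !cstME (rmorphXn cstM). Qed.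

Lemma cst_1subX n : cst (1 - tt ^+ n) = 1 - cst tt ^+ n.
Proof. by rewrite !cstME (rmorphB cstM) (rmorph1 cstM) (rmorphXn cstM). Qed.

Lemma newton_q : newton (fun j => (1 - cst tt ^+ j.+1) * pv j) hk1mt.
Proof.
apply: newton_ext (newton_rmorph (sb cstM (fun v => match v with
  | inl i => xv i | inr j => (1 - tt ^+ j.+1) *: pv j end)) newton_hk) => j /=.
by rewrite sb_pv (Pol_scale _ (pv j)) cst_1subX.
Qed.

Definition polycst : {rmorphism F -> {poly Pol}} := polyC \o cstM.

Definition phi : {rmorphism Pol -> {poly Pol}} :=
  sb polycst (fun v => match v with
                    | inl i => (xv i)%:P
                    | inr j => (pv j)%:P - 'X^(j.+1)
                    end).

Lemma phi_pv j : phi (pv j) = (pv j)%:P - 'X^(j.+1).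
Proof. exact: sb_pv. Qed.

Lemma phi_cst a : phi (cst a) = (cst a)%:P.
Proof. exact: sbC. Qed.

Lemma JingE n f : Jing n f = jing hk1mt phi n f.
Proof. by []. Qed.

Lemma JingD n f g : Jing n (f + g) = Jing n f + Jing n g.
Proof. by rewrite !JingE jingD. Qed.

Lemma JingZ n a f : Jing n (cst a * f) = cst a * Jing n f.
Proof. rewrite !JingE; exact: jingZ (phi_cst a). Qed.

Lemma Jing0 n : Jing n 0 = 0.
Proof. by rewrite JingE jing0. Qed.

Lemma Jing1 n : Jing n 1 = hk1mt n.
Proof. by rewrite JingE jing1. Qed.

Lemma Jing_elem k n f : elem k * Jing n f =
  Jing n (elem k * f) + Jing n.+1 (shift elem k * f).
Proof. rewrite !JingE; exact: (jing_elem hk1mt tf_Pol newton_elem phi_pv). Qed.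

Lemma Jing1_elem k : Jing 1 (elem k) = cst (1 - tt ^+ k.+1) * elem k.+1.
Proof.
rewrite cst_1subX JingE.
exact: (jing1_elem tf_Pol newton_elem newton_q phi_pv).
Qed.

Lemma hk1mt_rec n : hk1mt n = cst ((-1) ^+ n) * (cst (tt ^+ n) * elem n -
  \sum_(i < n) cst ((-1) ^+ i) * (elem (n - i) * hk1mt i)).
Proof.
apply: (q_rec tf_Pol newton_elem newton_q (s := fun i => cst ((-1) ^+ i))
  (w := fun i => cst (tt ^+ i))) => i; last exact: cst_exp.
by rewrite cst_exp cst_opp cst1.
Qed.

Definition Jrel m n f := Jing m (Jing n.+1 f) - cst tt * Jing m.+1 (Jing n f)
  + Jing n (Jing m.+1 f) - cst tt * Jing n.+1 (Jing m f).

Lemma JrelE m n f : Jrel m n f = jrel (cst tt) hk1mt phi m n f.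
Proof. by rewrite /Jrel /jrel -!JingE. Qed.

Lemma JrelD m n f g : Jrel m n (f + g) = Jrel m n f + Jrel m n g.
Proof. rewrite !JrelE; exact: jrelD. Qed.

Lemma JrelZ m n a f : Jrel m n (cst a * f) = cst a * Jrel m n f.
Proof. rewrite !JrelE; exact: jrelZ (phi_cst a). Qed.

Definition elems (rho : seq nat) : Pol := \prod_(k <- rho) elem k.

Lemma Jrel_elems rho m n : Jrel m n (elems rho) = 0.
Proof.
elim: rho m n => [|k rho IH] m n; rewrite JrelE.
  rewrite /elems big_nil; exact: (jrel1 tf_Pol newton_q (phi_cst tt) phi_pv).
rewrite /elems big_cons.
apply: (jrel_elem tf_Pol newton_elem phi_pv) => a b.
by rewrite -JrelE IH.
Qed.

(** * Linear spans and products of Jing operators *)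

Section Span.
Context (T : Type).
Implicit Types (Q : T -> Prop) (g : T -> Pol).

(** An inductive predicate lets closure properties go through without index sets or coefficient
    families; [Fspan_list] recovers these when they are wanted. *)
Inductive Fspan Q g : Pol -> Prop :=
| Fspan0 : Fspan Q g 0
| Fspan_cons a x f : Q x -> Fspan Q g f -> Fspan Q g (cst a * g x + f).

Lemma Fspan_gen Q g x : Q x -> Fspan Q g (g x).
Proof.
by move=> Qx; rewrite -[g x]addr0 -[g x]mul1r -cst1; apply: Fspan_cons => //; left.
Qed.

Lemma Fspan_eq Q g f f' : f = f' -> Fspan Q g f' -> Fspan Q g f.
Proof. by move=> ->. Qed.

Lemma FspanD Q g f f' : Fspan Q g f -> Fspan Q g f' -> Fspan Q g (f + f').
Proof.
move=> + h'; elim=> [|a x u Qx _ IH]; first by rewrite add0r.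
by rewrite -addrA; apply: Fspan_cons.
Qed.

Lemma FspanZ Q g a f : Fspan Q g f -> Fspan Q g (cst a * f).
Proof.
elim=> [|b x u Qx _ IH]; first by rewrite mulr0; left.
by rewrite mulrDr mulrA -cst_mul; apply: Fspan_cons.
Qed.

Lemma FspanB Q g f f' : Fspan Q g f -> Fspan Q g f' -> Fspan Q g (f - f').
Proof. by move=> h h'; rewrite -mulN1r -cst1 -cst_opp; apply/FspanD/FspanZ. Qed.

Lemma Fspan_sum (I : Type) (r : seq I) (A : pred I) Q g (G : I -> Pol) :
  (forall i, A i -> Fspan Q g (G i)) -> Fspan Q g (\sum_(i <- r | A i) G i).
Proof.
by move=> h; elim/big_ind: _ => //; [left | move=> *; apply: FspanD].
Qed.

Lemma Fspan_imp Q Q' g f : (forall x, Q x -> Q' x) -> Fspan Q g f -> Fspan Q' g f.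
Proof.
by move=> h; elim=> [|a x u Qx _ IH]; [left | right => //; apply: h].
Qed.

End Span.

Definition Flinear (L : Pol -> Pol) :=
  (forall f g, L (f + g) = L f + L g) /\ (forall a f, L (cst a * f) = cst a * L f).

Lemma Flinear0 L : Flinear L -> L 0 = 0.
Proof. by move=> [_ LZ]; have := LZ 0 0; rewrite cst0 !mul0r. Qed.

Lemma Fspan_map T U (Q : T -> Prop) (g : T -> Pol) (R : U -> Prop) (h : U -> Pol) L f :
  Flinear L -> (forall x, Q x -> Fspan R h (L (g x))) ->
  Fspan Q g f -> Fspan R h (L f).
Proof.
move=> Ll H; elim=> [|a x u Qx _ IH]; first by rewrite Flinear0 //; left.
by rewrite Ll.1 Ll.2; apply: FspanD => //; apply/FspanZ/H.
Qed.

Lemma Fspan_sub T U (Q : T -> Prop) (g : T -> Pol) (R : U -> Prop) (h : U -> Pol) f :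
  (forall x, Q x -> Fspan R h (g x)) -> Fspan Q g f -> Fspan R h f.
Proof. exact: (@Fspan_map _ _ _ _ _ _ id). Qed.

Lemma Fspan_eq0 T (Q : T -> Prop) (g : T -> Pol) L f :
  Flinear L -> (forall x, Q x -> L (g x) = 0) -> Fspan Q g f -> L f = 0.
Proof.
move=> Ll H; elim=> [|a x u Qx _ IH]; first exact: Flinear0.
by rewrite Ll.1 Ll.2 H // mulr0 IH add0r.
Qed.

Lemma Jing_lin n : Flinear (Jing n).
Proof. by split=> *; [apply: JingD | apply: JingZ]. Qed.

Lemma mul_lin h : Flinear ( *%R h).
Proof. by split=> *; [rewrite mulrDr | rewrite mulrCA]. Qed.

Lemma comp_lin L M : Flinear L -> Flinear M -> Flinear (L \o M).
Proof. by move=> [LD LZ] [MD MZ]; split=> * /=; rewrite ?MD ?MZ ?LD ?LZ. Qed.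

Definition Jings (nu : seq nat) (f : Pol) : Pol := foldr Jing f nu.
(** For a partition nu this is the Hall-Littlewood function Q_nu(x; t). *)
Definition HL nu := Jings nu 1.

Lemma Jings_lin nu : Flinear (Jings nu).
Proof.
elim: nu => [|n nu IH]; first by split.
exact: (comp_lin (Jing_lin n) IH).
Qed.

Lemma Jings_cat a b f : Jings (a ++ b) f = Jings a (Jings b f).
Proof. by rewrite /Jings foldr_cat. Qed.

Lemma HL_cat0 nu r : HL (nu ++ nseq r 0%N) = HL nu.
Proof.
rewrite /HL Jings_cat; congr (Jings nu _).
by elim: r => //= r ->; rewrite Jing1; case: newton_q.
Qed.

Lemma hk1mt_span n : Fspan (fun rho => sumn rho = n) elems (hk1mt n).
Proof.
elim/ltn_ind: n => n IH.
rewrite hk1mt_rec; apply/FspanZ/FspanB.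
  have -> : elem n = elems [:: n] by rewrite /elems big_seq1.
  by apply/FspanZ/Fspan_gen; rewrite /= addn0.
apply: Fspan_sum => -[i ilt] _ /=.
apply: FspanZ.
apply: Fspan_map (mul_lin _) _ (IH i ilt) => r sr.
have -> : elem (n - i) * elems r = elems (n - i :: r)%N by rewrite /elems big_cons.
by apply: Fspan_gen => /=; rewrite sr subnK // ltnW.
Qed.

Lemma elems_cons k rho : elems (k :: rho) = elem k * elems rho.
Proof. by rewrite /elems big_cons. Qed.

Lemma elems_nil : elems [::] = 1.
Proof. by rewrite /elems big_nil. Qed.

(** Solve the commutation rule for B_n(e_{k+1} f) = e_{k+1} B_n f - B_{n+1}(e_k f): the first term
    has a shorter rho, the second a smaller k, and the degree n + |rho| is kept. *)
Lemma Jing_elems_span n rho :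
  Fspan (fun r => sumn r = n + sumn rho)%N elems (Jing n (elems rho)).
Proof.
elim: rho n => [|k rho IH] n.
  by rewrite elems_nil Jing1 addn0; exact: hk1mt_span.
rewrite elems_cons; elim: k n => [|k IHk] n; first by rewrite elem0 mul1r; exact: IH.
have /eqP := Jing_elem k.+1 n (elems rho); rewrite -subr_eq => /eqP <-.
apply: FspanB.
  apply: Fspan_map (mul_lin _) _ (IH n) => r sr; rewrite -elems_cons.
  by apply: Fspan_gen => /=; rewrite sr; lia.
by apply: Fspan_imp (IHk n.+1) => r -> /=; lia.
Qed.

Lemma Jing_span n d f : Fspan (fun r => sumn r = d) elems f ->
  Fspan (fun r => sumn r = n + d)%N elems (Jing n f).
Proof.
by apply: Fspan_map (Jing_lin n) _ => r <-; exact: Jing_elems_span.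
Qed.

Lemma HL_span_elems nu : Fspan (fun r => sumn r = sumn nu) elems (HL nu).
Proof.
elim: nu => [|n nu IH]; last exact: Jing_span.
by rewrite /HL /= -elems_nil; exact: Fspan_gen.
Qed.

Lemma Jrel_lin m n : Flinear (Jrel m n).
Proof. by split=> *; [apply: JrelD | apply: JrelZ]. Qed.

Lemma Jrel_HL m n nu : Jrel m n (HL nu) = 0.
Proof.
apply: Fspan_eq0 (Jrel_lin m n) _ (HL_span_elems nu) => r _; exact: Jrel_elems.
Qed.

Lemma FlinearB L f g : Flinear L -> L (f - g) = L f - L g.
Proof.
move=> Ll; have N h : - h = cst (- 1) * h by rewrite cst_opp cst1 mulN1r.
by rewrite N Ll.1 Ll.2 -N.
Qed.

Lemma HL_rel pre m n post : HL (pre ++ m :: n.+1 :: post) =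
  cst tt * HL (pre ++ m.+1 :: n :: post) - HL (pre ++ n :: m.+1 :: post)
  + cst tt * HL (pre ++ n.+1 :: m :: post).
Proof.
have gen (P : comNzRingType) (a b c d : P) : a - b + c - d = 0 -> a = b - c + d.
  by move=> h; rewrite -[RHS]add0r -h; ring.
have HL2 a b : HL (pre ++ a :: b :: post) = Jings pre (Jing a (Jing b (HL post))).
  exact: Jings_cat.
have [LD LZ] := Jings_lin pre; have LB := FlinearB _ _ (Jings_lin pre).
rewrite !HL2 (gen _ _ _ _ _ (Jrel_HL m n post)) LD LB.
by congr (_ - _ + _); apply: LZ.
Qed.

(** * Straightening and the Pieri rule *)

Definition N2 (s : seq nat) := sumn [seq (x ^ 2)%N | x <- s].

(** The statistic sum_i i nu_i with positions counted from 0. It drops when the larger of two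
    adjacent entries moves left, and so breaks ties in N2. *)
Fixpoint idx (s : seq nat) : nat :=
  if s is x :: s' then (idx s' + sumn s')%N else 0%N.

Lemma N2_cat a b : N2 (a ++ b) = (N2 a + N2 b)%N.
Proof. by rewrite /N2 map_cat sumn_cat. Qed.

Lemma idx_cat a b : idx (a ++ b) = (idx a + idx b + size a * sumn b)%N.
Proof.
elim: a => [|x a IH] /=; first by rewrite addn0.
rewrite IH sumn_cat mulSn; lia.
Qed.

Lemma unsorted_split s : ~~ sorted geq s ->
  exists pre x y post, s = pre ++ x :: y :: post /\ (x < y)%N.
Proof.
elim: s => //= x [|y s] IH //=.
rewrite negb_and; case: (leqP y x) => /= [_ /IH|xy _].
  by move=> [pre [a [b [post [-> ab]]]]]; exists (x :: pre), a, b, post.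
by exists [::], x, y, s.
Qed.

Definition lower_sorted nu ka :=
  [/\ sorted geq ka, sumn ka = sumn nu & (N2 ka <= N2 nu)%N].

Lemma straighten nu : Fspan (lower_sorted nu) HL (HL nu).
Proof.
(* Lexicographic induction on (N2, idx), applied to the three terms of [HL_rel] at an ascent m < n +
   1. *)
move: {2}(N2 nu) (leqnn (N2 nu)) => N; elim/ltn_ind: N nu => N IHN nu.
move: {2}(idx nu) (leqnn (idx nu)) => I; elim/ltn_ind: I nu => I IHI nu nuI nuN.
have [snu|/unsorted_split[pre [m [r [post [E mn]]]]]] := boolP (sorted geq nu).
  exact: Fspan_gen.
case: r => // n in E mn.
have step a b : (a + b = m + n.+1)%N -> (a ^ 2 + b ^ 2 <= m ^ 2 + n.+1 ^ 2)%N ->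
    (a ^ 2 + b ^ 2 < m ^ 2 + n.+1 ^ 2)%N \/ (b < n.+1)%N ->
    Fspan (lower_sorted nu) HL (HL (pre ++ a :: b :: post)).
  move=> ab1 ab2 ab3; pose nu' := pre ++ a :: b :: post.
  have sE : sumn nu' = sumn nu by rewrite E !sumn_cat /=; lia.
  have nE : (N2 nu' + (m ^ 2 + n.+1 ^ 2) = N2 nu + (a ^ 2 + b ^ 2))%N.
    by rewrite E !N2_cat /N2 /=; lia.
  have iE : (idx nu' + n.+1 = idx nu + b)%N.
    rewrite E !idx_cat /= (_ : a + (b + sumn post) = m + (n.+1 + sumn post))%N; lia.
  have imp ka : lower_sorted nu' ka -> lower_sorted nu ka.
    move=> [h1 h2 h3]; split=> //; first by rewrite h2.
    by apply: leq_trans h3 _; lia.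
  apply: Fspan_imp imp _; case: (ltnP (N2 nu') (N2 nu)) => h.
    by apply: (IHN (N2 nu')) => //; lia.
  by apply: (IHI (idx nu')) => //; lia.
have h1 : Fspan (lower_sorted nu) HL (HL (pre ++ n.+1 :: m :: post)).
  by apply: step; lia.
have := HL_rel pre m n post; rewrite -E => R.
(* For m = n the relation contains its own left side again: it says 2A = 2tB, and torsion-freeness
   removes the 2. *)
have [mEn|mn'] := eqVneq m n.
  have gen (P : comNzRingType) (A B c : P) : torsionfree P ->
      A = c * B - A + c * B -> A = c * B.
    move=> tf h; apply/eqP; rewrite -subr_eq0; apply/eqP/(tf _ 1).
    by rewrite mulr2n {1}h; ring.
  move: R h1; rewrite E mEn => R h1.
  by rewrite (gen _ _ _ _ tf_Pol R); apply: FspanZ.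
(* For m < n the two remaining terms lower N2 by 2(n - m). *)
rewrite R; apply: FspanD (FspanZ _ h1); apply: FspanB; first apply: FspanZ.
  by apply: step; nia.
by apply: step; nia.
Qed.

(* [vs M k] lists the 0/1 vectors of length M and sum k; [cs M rho] lists, with
   multiplicity, the exponents of the monomials of e_rho in M variables. *)
Fixpoint vs (M k : nat) : seq (seq nat) :=
  match M with
  | 0 => if k == 0%N then [:: [::]] else [::]
  | M'.+1 => [seq 0%N :: v | v <- vs M' k] ++
      (if k is k'.+1 then [seq 1%N :: v | v <- vs M' k'] else [::])
  end.

Fixpoint vadd (a b : seq nat) : seq nat :=
  match a, b with x :: a', y :: b' => (x + y)%N :: vadd a' b' | _, _ => [::] end.

Fixpoint cs (M : nat) (rho : seq nat) : seq (seq nat) :=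
  if rho is k :: r then [seq vadd v b | v <- vs M k, b <- cs M r]
  else [:: nseq M 0%N].

Lemma vs_cons M k v : v \in vs M.+1 k ->
  (exists2 w, v = 0%N :: w & w \in vs M k) \/
  (exists k' w, [/\ k = k'.+1, v = 1%N :: w & w \in vs M k']).
Proof.
rewrite /= mem_cat => /orP[/mapP[w h ->]|]; first by left; exists w.
by case: k => // k /mapP[w h ->]; right; exists k, w.
Qed.

Lemma vs0 M k w : w \in vs M k -> 0%N :: w \in vs M.+1 k.
Proof. by move=> h; rewrite /= mem_cat map_f. Qed.

Lemma vs1 M k w : w \in vs M k -> 1%N :: w \in vs M.+1 k.+1.
Proof. by move=> h; rewrite /= mem_cat map_f ?orbT. Qed.

Lemma vs_size M k v : v \in vs M k -> size v = M.
Proof.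
elim: M k v => [|M IH] k v; first by rewrite /=; case: ifP => //; rewrite inE => _ /eqP->.
by move/vs_cons => [[w -> /IH/= ->]|[k' [w [_ -> /IH/= ->]]]].
Qed.

Lemma vs_sumn M k v : v \in vs M k -> sumn v = k.
Proof.
elim: M k v => [|M IH] k v.
  by rewrite /=; case: eqP => // ->; rewrite inE => /eqP->.
by move/vs_cons => [[w -> /IH/= ->]|[k' [w [-> -> /IH/= ->]]]].
Qed.

Lemma vadd_size a b : size a = size b -> size (vadd a b) = size a.
Proof. by elim: a b => [|x a IH] [|y b] //= [/IH->]. Qed.

Lemma vadd_cat a b a' b' : size a = size b ->
  vadd (a ++ a') (b ++ b') = vadd a b ++ vadd a' b'.
Proof. by elim: a b => [|x a IH] [|y b] //= [/IH->]. Qed.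

Lemma vadd0 a : vadd a (nseq (size a) 0%N) = a.
Proof. by elim: a => //= x a ->; rewrite addn0. Qed.

Lemma csP M k r b : b \in cs M (k :: r) ->
  exists v c, [/\ v \in vs M k, c \in cs M r & b = vadd v c].
Proof. by move/allpairsP => [[v c] [/= h1 h2 ->]]; exists v, c. Qed.

Lemma cs_size M r b : b \in cs M r -> size b = M.
Proof.
elim: r b => [|k r IH] b; first by rewrite inE => /eqP->; rewrite size_nseq.
move/csP => [v [c [hv hc ->]]].
by rewrite vadd_size (vs_size hv) ?(IH _ hc).
Qed.

Lemma vs_nseq0 j : nseq j 0%N \in vs j 0.
Proof. by elim: j => //= j IH; rewrite cats0 map_f. Qed.

Lemma vs_nseq1 j : nseq j 1%N \in vs j j.
Proof. by elim: j => // j IH; apply: vs1. Qed.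

Lemma vs_cat M M' k k' v w :
  v \in vs M k -> w \in vs M' k' -> v ++ w \in vs (M + M') (k + k').
Proof.
move=> + hw; elim: M k v => [|M IH] k v.
  by rewrite /=; case: eqP => // ->; rewrite inE => /eqP->.
rewrite addSn => /vs_cons [[u -> /IH h]|[l [u [-> -> /IH h]]]] /=; first exact: vs0.
exact: vs1.
Qed.

Lemma cs_cat0 M j r b : b \in cs M r -> b ++ nseq j 0%N \in cs (M + j) r.
Proof.
elim: r b => [|k r IH] b.
  by rewrite !inE => /eqP->; rewrite -nseqD.
move/csP => [v [c [hv hc ->]]].
apply/allpairsP; exists (v ++ nseq j 0%N, c ++ nseq j 0%N) => /=; split.
- by rewrite -[k]addn0; apply: vs_cat hv (vs_nseq0 j).
- exact: IH.
have sz : size v = size c by rewrite (vs_size hv) (cs_size hc).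
rewrite vadd_cat //; congr (_ ++ _).
by have := vadd0 (nseq j 0%N); rewrite size_nseq.
Qed.

Lemma elem_HL j : exists c, elem j = cst c * HL (nseq j 1%N).
Proof.
elim: j => [|j [c IH]].
  by exists 1; rewrite elem0 cst1 mul1r.
have h := one_sub_tt_neq0 j; exists ((1 - tt ^+ j.+1)^-1 * c).
have e1 : Jing 1 (elem j) = cst c * HL (nseq j.+1 1%N).
  by rewrite IH; exact: JingZ.
have gen (P : comNzRingType) (a' a b e x y : P) :
    a' * a = 1 -> x = a * e -> x = b * y -> e = a' * b * y.
  by move=> h1 h2 h3; rewrite -mulrA -h3 h2 mulrA h1 mul1r.
rewrite cst_mul; apply: gen (Jing1_elem j) e1.
by rewrite -cst_mul (mulVf h) cst1.
Qed.

(** Push e_k to the right through the word. In p = (v, j), the vector v marks the operators whose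
    index was raised and j is the degree of the factor that comes out at the end. *)
Lemma pieri k nu f :
  Fspan (fun p => p.1 \in vs (size nu) (k - p.2) /\ (p.2 <= k)%N)
    (fun p => Jings (vadd p.1 nu) (elem p.2 * f)) (elem k * Jings nu f).
Proof.
elim: nu k => [|n nu IH] k.
  by apply: (@Fspan_gen _ _ _ ([::], k)) => /=; rewrite subnn.
apply: (Fspan_eq (Jing_elem k n (Jings nu f))); apply: FspanD.
  apply: Fspan_map (Jing_lin n) _ (IH k) => -[v j] [/= hv jk].
  by apply: (@Fspan_gen _ _ _ (0%N :: v, j)); split=> //; apply: vs0.
case: k => [|k] /=.
  by apply: (Fspan_eq (f' := 0)); [rewrite (mul0r (Jings nu f)) Jing0 | left].
apply: Fspan_map (Jing_lin n.+1) _ (IH k) => -[v j] [/= hv jk].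
apply: (@Fspan_gen _ _ _ (1%N :: v, j)); split=> /=; last exact: leqW.
by rewrite subSn //; apply: vs1.
Qed.

Lemma elems_span_HL rho : Fspan (fun b => exists M, b \in cs M rho) HL (elems rho).
Proof.
elim: rho => [|k rho IH].
  rewrite elems_nil; have -> : 1 = HL [::] by [].
  by apply: Fspan_gen; exists 0%N; rewrite inE.
rewrite elems_cons; apply: Fspan_map (mul_lin _) _ IH => b [M hb].
apply: Fspan_sub (pieri k b 1) => -[v j] [/= hv jk].
have [c Ec] := elem_HL j.
have E : Jings (vadd v b) (elem j * 1) = cst c * HL (vadd v b ++ nseq j 1%N).
  by rewrite (mulr1 (elem j)) Ec /HL Jings_cat; apply: (Jings_lin _).2.
apply: (Fspan_eq E); apply/FspanZ/Fspan_gen.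
(* The leftover e_j is a multiple of B_1^j 1, so it appends j ones to the word; they are counted as
   part of the 0/1 vector of sum k, and b is padded by zeros. *)
exists (M + j)%N; apply/allpairsP; exists (v ++ nseq j 1%N, b ++ nseq j 0%N) => /=.
rewrite (cs_size hb) in hv.
split; last 1 first.
- rewrite vadd_cat ?(vs_size hv) ?(cs_size hb) //; congr (_ ++ _).
  by have := vadd0 (nseq j 1%N); rewrite size_nseq.
- by rewrite -(subnK jk); apply: vs_cat hv (vs_nseq1 j).
exact: cs_cat0.
Qed.

(** * The order on compositions *)

Fixpoint dot (a b : seq nat) : nat :=
  match a, b with x :: a', y :: b' => (x * y + dot a' b')%N | _, _ => 0%N end.

Definition mins k r := sumn [seq minn k j | j <- r].

(* The largest value of [N2] on [cs M rho]. *)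
Fixpoint wt (rho : seq nat) : nat :=
  if rho is k :: r then (k + 2 * mins k r + wt r)%N else 0%N.

Lemma N2_cons x a : N2 (x :: a) = (x ^ 2 + N2 a)%N.
Proof. by []. Qed.

Lemma dot_diag a : dot a a = N2 a.
Proof. by elim: a => //= x a ->; rewrite N2_cons -mulnn. Qed.

Lemma N2_vadd a b : size a = size b ->
  N2 (vadd a b) = (N2 a + N2 b + 2 * dot a b)%N.
Proof.
elim: a b => [|x a IH] [|y b] //= [/IH]; rewrite !N2_cons => ->; nia.
Qed.

Lemma sumn_vadd a b : size a = size b -> sumn (vadd a b) = (sumn a + sumn b)%N.
Proof. elim: a b => [|x a IH] [|y b] //= [/IH ->]; lia. Qed.

Lemma dot_vaddr a b c : size b = size c ->
  dot a (vadd b c) = (dot a b + dot a c)%N.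
Proof.
elim: a b c => [|x a IH] [|y b] [|z c] //= [/IH ->]; rewrite mulnDr; lia.
Qed.

Lemma dot0r a n : dot a (nseq n 0%N) = 0%N.
Proof. by elim: a n => [|x a IH] [|n] //=; rewrite IH muln0. Qed.

Lemma N2_vs M k v : v \in vs M k -> N2 v = k.
Proof.
elim: M k v => [|M IH] k v.
  by rewrite /=; case: eqP => // ->; rewrite inE => /eqP->.
by move/vs_cons => [[w -> /IH h]|[l [w [-> -> /IH h]]]]; rewrite N2_cons h.
Qed.

Lemma dot_vs M k j v u : v \in vs M k -> u \in vs M j -> (dot v u <= minn k j)%N.
Proof.
elim: M k j v u => [|M IH] k j v u.
  by rewrite /=; case: eqP => // ->; rewrite inE => /eqP->.
move/vs_cons => [[w -> hw]|[k' [w [-> -> hw]]]];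
  move/vs_cons => [[x -> hx]|[j' [x [-> -> hx]]]] /=;
  have := IH _ _ _ _ hw hx; lia.
Qed.

Lemma dot_vs_cs M k r v c : v \in vs M k -> c \in cs M r -> (dot v c <= mins k r)%N.
Proof.
move=> hv; elim: r c => [|j r IH] c; first by rewrite inE => /eqP->; rewrite dot0r.
move/csP => [u [d [hu hd ->]]].
rewrite dot_vaddr ?(vs_size hu) ?(cs_size hd) // /mins /=.
exact: leq_add (dot_vs hv hu) (IH _ hd).
Qed.

Lemma N2_nseq0 n : N2 (nseq n 0%N) = 0%N.
Proof. by elim: n. Qed.

Lemma N2_cs M r b : b \in cs M r -> (N2 b <= wt r)%N.
Proof.
elim: r b => [|k r IH] b; first by rewrite inE => /eqP->; rewrite N2_nseq0.
move/csP => [v [c [hv hc ->]]].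
rewrite N2_vadd ?(vs_size hv) ?(cs_size hc) // (N2_vs hv) /=.
have := IH _ hc; have := dot_vs_cs hv hc; lia.
Qed.

Lemma sumn_nseq0 n : sumn (nseq n 0%N) = 0%N.
Proof. by elim: n. Qed.

Lemma sumn_cs M r b : b \in cs M r -> sumn b = sumn r.
Proof.
elim: r b => [|k r IH] b; first by rewrite inE => /eqP->; rewrite sumn_nseq0.
move/csP => [v [c [hv hc ->]]].
by rewrite sumn_vadd ?(vs_size hv) ?(cs_size hc) // (vs_sumn hv) (IH _ hc).
Qed.

Fixpoint iv (M k : nat) : seq nat :=
  match M, k with
  | 0, _ => [::]
  | M'.+1, 0 => 0%N :: iv M' 0
  | M'.+1, k'.+1 => 1%N :: iv M' k'
  end.

(* The conjugate of rho, padded with zeros to length M. *)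
Definition top M rho := foldr (fun k b => vadd (iv M k) b) (nseq M 0%N) rho.

Lemma iv_size M k : size (iv M k) = M.
Proof. by elim: M k => //= M IH [|k] /=; rewrite IH. Qed.

Lemma iv_vs M k : (k <= M)%N -> iv M k \in vs M k.
Proof.
by elim: M k => [|M IH] [|k] // h; [apply: vs0 | apply: vs1]; apply: IH.
Qed.

Lemma top_size M r : size (top M r) = M.
Proof.
elim: r => [|k r IH] /=; first by rewrite size_nseq.
by rewrite vadd_size ?iv_size ?IH.
Qed.

Lemma top_cs M r : all (fun k => k <= M)%N r -> top M r \in cs M r.
Proof.
elim: r => [|k r IH] /= => [_|/andP[kM /IH h]]; first by rewrite inE.
by apply/allpairsP; exists (iv M k, top M r); rewrite /= iv_vs.
Qed.

Lemma dot_iv M k j : (k <= M)%N -> (j <= M)%N -> dot (iv M k) (iv M j) = minn k j.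
Proof.
elim: M k j => [|M IH] [|k] [|j] //= hk hj; rewrite IH //; lia.
Qed.

Lemma dot_iv_top M k r : (k <= M)%N -> all (fun j => j <= M)%N r ->
  dot (iv M k) (top M r) = mins k r.
Proof.
move=> kM; elim: r => [|j r IH] /= => [_|/andP[jM /IH h]]; first by rewrite dot0r.
by rewrite dot_vaddr ?iv_size ?top_size // dot_iv // h.
Qed.

Lemma N2_top M r : all (fun k => k <= M)%N r -> N2 (top M r) = wt r.
Proof.
elim: r => [|k r IH] /= => [_|/andP[kM hr]]; first by rewrite N2_nseq0.
rewrite N2_vadd ?iv_size ?top_size // (N2_vs (iv_vs kM)) dot_iv_top // IH //; lia.
Qed.

Lemma nth_iv M k i : (i < M)%N -> nth 0%N (iv M k) i = (i < k)%N.
Proof.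
elim: M k i => [|M IH] [|k] [|i] //= h; rewrite IH //.
Qed.

Lemma nth_vadd a b i : size a = size b ->
  nth 0%N (vadd a b) i = (nth 0%N a i + nth 0%N b i)%N.
Proof.
by elim: a b i => [|x a IH] [|y b] [|i] //= [/IH->].
Qed.

Lemma nth_top M r i : (i < M)%N -> nth 0%N (top M r) i = count (ltn i) r.
Proof.
move=> iM; elim: r => [|k r IH] /=; first by rewrite nth_nseq iM.
by rewrite nth_vadd ?iv_size ?top_size // nth_iv // IH.
Qed.

Lemma top_sorted M r : sorted geq (top M r).
Proof.
apply/(sortedP 0%N) => i; rewrite top_size => iM.
rewrite !nth_top // 1?ltnW //; apply: sub_count => x /=; exact: ltnW.
Qed.

(** Passing from k to k + 1 picks up at most one more entry of c, and g bounds all of them. *)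
Lemma dot_iv_step g c M k : path geq g c ->
  (dot c (iv M k.+1) <= g + dot c (iv M k))%N.
Proof.
elim: c g M k => [|h c IH] g [|M] k //= /andP[hg pc].
by case: k => [|k] /=; [lia | have := IH h M k pc; lia].
Qed.

(** Rearrangement: against a decreasing g, the ones are best placed at the front. *)
Lemma dot_vs_iv g M k v : sorted geq g -> v \in vs M k ->
  (dot g v <= dot g (iv M k))%N.
Proof.
elim: M g k v => [|M IH] g k v.
  by rewrite /=; case: eqP => // _; rewrite inE => _ /eqP->.
case: g => [|x g] // sg.
have sg' : sorted geq g := path_sorted sg.
move/vs_cons => [[w -> /(IH g _ _ sg') h]|[l [w [-> -> /(IH g _ _ sg') h]]]] /=.
  case: k h => [|k] h; first by lia.
  have := dot_iv_step M k sg; lia.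
lia.
Qed.

Lemma dot_cs_top g M r b : sorted geq g -> b \in cs M r ->
  (dot g b <= dot g (top M r))%N.
Proof.
move=> sg; elim: r b => [|k r IH] b; first by rewrite inE => /eqP->.
move/csP => [v [c [hv hc ->]]] /=.
rewrite !dot_vaddr ?iv_size ?top_size ?(vs_size hv) ?(cs_size hc) //.
exact: leq_add (dot_vs_iv sg hv) (IH _ hc).
Qed.

Lemma cauchy a b : size a = size b -> (2 * dot a b <= N2 a + N2 b)%N.
Proof.
elim: a b => [|x a IH] [|y b] //= [/IH h]; rewrite !N2_cons.
have [h1 _] := nat_Cauchy x y; lia.
Qed.

Lemma cauchy_eq a b : size a = size b -> (N2 a + N2 b <= 2 * dot a b)%N -> a = b.
Proof.
elim: a b => [|x a IH] [|y b] //= [h]; rewrite !N2_cons => h'.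
have hc := cauchy h; have [h1 h2] := nat_Cauchy x y.
have /eqP E : x == y by rewrite -h2; apply/eqP; lia.
rewrite E -mulnn in h' *; congr (_ :: _); apply: IH => //; lia.
Qed.

(* |top rho|^2 <= top rho . top rho' because top rho is decreasing; conclude by
   Cauchy-Schwarz. *)
Lemma top_in_cs M r r' : all (fun k => k <= M)%N r -> all (fun k => k <= M)%N r' ->
  top M r \in cs M r' ->
  (wt r <= wt r')%N /\ (wt r = wt r' -> top M r = top M r').
Proof.
move=> hr hr' /(dot_cs_top (top_sorted M r)); rewrite dot_diag => h.
have sz : size (top M r) = size (top M r') by rewrite !top_size.
have := cauchy sz; have := cauchy_eq sz; rewrite !N2_top // in h *.
by move=> he hc; split=> [|E]; [lia | apply: he; lia].
Qed.

(** The entries of [top] count the parts exceeding i; multiplicities are differences of consecutive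
    counts. The bound M on the parts ensures that nothing is cut off. *)
Lemma top_inj M r r' : is_partition r -> is_partition r' ->
  all (fun k => k <= M)%N r -> all (fun k => k <= M)%N r' ->
  top M r = top M r' -> r = r'.
Proof.
move=> /andP[sr pr] /andP[sr' pr'] hr hr' E.
have cE i : count (ltn i) r = count (ltn i) r'.
  case: (ltnP i M) => iM; first by rewrite -!(@nth_top M) // E.
  have z s : all (fun k => k <= M)%N s -> count (ltn i) s = 0%N.
    move=> /allP h; apply/eqP; rewrite -leqn0 leqNgt -has_count; apply/hasPn => x /h.
    by rewrite /= -leqNgt => /leq_trans; apply.
  by rewrite !z.
have mE s i : count_mem i.+1 s = (count (ltn i) s - count (ltn i.+1) s)%N.
  elim: s => //= x s ->; have : (count (ltn i.+1) s <= count (ltn i) s)%N.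
    by apply: sub_count => y /=; apply: ltnW.
  by case: (ltngtP i.+1 x) => h; lia.
have z s : all (fun x => 0 < x)%N s -> count_mem 0%N s = 0%N.
  by move/allP => h; apply/count_memPn/negP => /h.
apply: (sorted_eq (leT := geq)) => //.
- by move=> a b c /= h1 h2; apply: leq_trans h2 h1.
- by move=> a b /= /andP[h1 h2]; apply/eqP; rewrite eqn_leq h1 h2.
by apply/allP => -[|x] _ /=; rewrite ?z // !mE !cE.
Qed.

Lemma dotE a b : size a = size b ->
  dot a b = (\sum_(i < size a) nth 0 a i * nth 0 b i)%N.
Proof.
elim: a b => [|x a IH] [|y b] //= => [_|[/IH h]]; first by rewrite big_ord0.
by rewrite big_ord_recl h.
Qed.

Lemma abel_leq (b x y : nat -> nat) n :
  (forall i, b i.+1 <= b i)%N ->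
  (forall k, k <= n -> \sum_(i < k) x i <= \sum_(i < k) y i)%N ->
  (\sum_(i < n) b i * x i <= \sum_(i < n) b i * y i)%N.
Proof.
move=> hb hxy.
(* Summation by parts: the stronger claim sum b_i (y_i - x_i) >= b_n sum (y_i - x_i), written
   without subtraction, carries the boundary term that the induction needs. *)
suff : (\sum_(i < n) b i * x i + b n * \sum_(i < n) y i <=
        \sum_(i < n) b i * y i + b n * \sum_(i < n) x i)%N.
  by have := leq_mul (leqnn (b n)) (hxy n (leqnn n)); lia.
elim: n hxy => [|n IH] hxy; first by rewrite !big_ord0.
have := IH (fun k kn => hxy k (leqW kn)); have := hxy n.+1 (leqnn _).
have := hb n; rewrite !big_ord_recr /=.
move: (\sum_(i < n) x i)%N (\sum_(i < n) y i)%N => X Y.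
move: (\sum_(i < n) b i * x i)%N (\sum_(i < n) b i * y i)%N => U V.
move: (b n.+1) (b n) (x n) (y n) => b1 b0 xn yn h1 h2 h3.
have := leq_mul h1 h2; have := leq_mul (leqnn (b0 - b1)%N) h2.
nia.
Qed.

Lemma N2_perm a b : perm_eq a b -> N2 a = N2 b.
Proof. by move=> h; apply/perm_sumn/perm_map. Qed.

(** For the sorted sequences, dominance and summation by parts give b.b <= b.a. With 2 a.b <= a.a +
    b.b this yields b.b <= a.a, and equality would force a = b. *)
Lemma dom_lt_N2 b a : dom_lt b a -> sumn b = sumn a /\ (N2 b < N2 a)%N.
Proof.
move=> /and4P[/eqP sz /eqP sm ne /allP h]; split=> //.
rewrite -(N2_perm (permEl (perm_sort geq b))) -(N2_perm (permEl (perm_sort geq a))).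
set a' := sort geq a in ne h *; set b' := sort geq b in ne h *.
have szab : size b' = size a' by rewrite !size_sort.
have geq_tot : total geq by move=> x y; apply: leq_total.
have sb : sorted geq b' := sort_sorted geq_tot b.
have : (dot b' b' <= dot b' a')%N.
  rewrite !dotE //; apply: abel_leq => [i|k kn].
    case: (ltnP i.+1 (size b')) => ib; last by rewrite [X in (X <= _)%N]nth_default.
    exact: (sortedP 0%N sb).
  by apply: (h k); rewrite mem_iota -(size_sort geq a) -/a' -szab.
rewrite dot_diag => h1; have := cauchy szab.
case: (ltnP (N2 b') (N2 a')) => // h2 _.
by case/eqP: ne; apply: cauchy_eq => //; lia.
Qed.

(** A step below a exchanges entries a_i < a_j with i < j. A decreasing composition therefore has
    nothing below it in its own orbit, and only the dominance part of the Bruhat order is left. *)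
Lemma clos_orbit_unsorted b a :
  Relation_Operators.clos_trans _ orbit_step b a -> ~~ sorted geq a.
Proof.
elim=> // {}b {}a [i [j [/andP[ij ja] [lt _]]]].
apply/negP => sa; move: lt; apply/negP; rewrite -leqNgt.
have geq_tr : transitive geq by move=> x y z /= h1 h2; apply: leq_trans h2 h1.
have geq_refl : reflexive geq by move=> x /=.
have := sorted_leq_nth geq_tr geq_refl 0%N sa; apply; rewrite ?inE //.
  exact: ltn_trans ij ja.
exact: ltnW.
Qed.

Lemma bruhat_lt_N2 b a : sorted geq a -> bruhat_lt b a ->
  sumn b = sumn a /\ (N2 b < N2 a)%N.
Proof.
by move=> sa [/dom_lt_N2 //|/clos_orbit_unsorted]; rewrite sa.
Qed.

(** * Triangularity of the expansion in x^alpha e_rho *)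

Section ElementarySym.
Context (P : comNzRingType) (x : nat -> P).

Fixpoint xsh n (v : seq nat) : P :=
  if v is a :: v' then x n ^+ a * xsh n.+1 v' else 1.

Lemma xsh_cat n a b : xsh n (a ++ b) = xsh n a * xsh (n + size a) b.
Proof.
elim: a n => [|y a IH] n /=; first by rewrite addn0 mul1r.
by rewrite IH addSnnS mulrA.
Qed.

Lemma xsh_vadd n a b : size a = size b -> xsh n (vadd a b) = xsh n a * xsh n b.
Proof.
elim: a b n => [|y a IH] [|z b] n //= => [_|[/IH ->]]; first by rewrite mulr1.
by rewrite exprD; ring.
Qed.

Lemma xsh_prod n v : xsh n v = \prod_(i < size v) x (n + i) ^+ nth 0 v i.
Proof.
elim: v n => [|a v IH] n; first by rewrite big_ord0.
rewrite big_ord_recl addn0 /= IH; congr (_ * _).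
by apply: eq_bigr => i _; rewrite /bump addSnnS.
Qed.

Definition symE n M k : P := \sum_(v <- vs M k) xsh n v.

(** Adjoining the variable x_n multiplies the generating series by 1 + x_n z: a 0/1 vector starts
    with 0 or with 1. *)
Lemma newton_symE n M : newton
  (fun j => (-1) ^+ j * \sum_(n <= i < n + M) x i ^+ j.+1) (symE n M).
Proof.
elim: M n => [|M IH] n.
  split=> [|k]; first by rewrite /symE /= big_seq1.
  rewrite /symE big_nil mul0rn big1 // => j _.
  by rewrite addn0 big_geq // mulr0 mul0r.
have [h0 hS] := newton_addlin (x n) (IH n.+1).
have E k : symE n M.+1 k = symE n.+1 M k + x n * shift (symE n.+1 M) k.
  rewrite /symE /= big_cat big_map /=; congr (_ + _).
    by apply: eq_bigr => v _; rewrite /= expr0 mul1r.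
  case: k => [|k]; first by rewrite big_nil mulr0.
  by rewrite big_map mulr_sumr; apply: eq_bigr => v _; rewrite /= expr1.
split=> [|k]; first by rewrite E.
rewrite E hS; apply: eq_bigr => j _; rewrite E; congr (_ * _).
by rewrite (@big_ltn _ _ _ n) ?addnS ?ltnS ?leq_addr // -addSn mulrDr addrC.
Qed.

Lemma symE_prod n M rho :
  \prod_(k <- rho) symE n M k = \sum_(b <- cs M rho) xsh n b.
Proof.
elim: rho => [|k rho IH].
  rewrite big_nil /= big_seq1; elim: M n => //= M IH n.
  by rewrite expr0 mul1r -IH.
rewrite big_cons IH /= big_allpairs_dep /symE mulr_suml.
apply: eq_big_seq => v hv; rewrite mulr_sumr.
apply: eq_big_seq => b hb.
by rewrite xsh_vadd // (vs_size hv) (cs_size hb).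
Qed.

End ElementarySym.

(** * Realization in finitely many variables *)

Definition realizeM k N : {rmorphism Pol -> Pol} :=
  sb cstM (fun v => match v with
                    | inl i => xv i
                    | inr j => \sum_(k <= i < N) xv i ^+ j.+1
                    end).

Lemma realizeM_xv k N i : realizeM k N (xv i) = xv i.
Proof. exact: sb_xv. Qed.

Lemma realizeM_pv k N j : realizeM k N (pv j) = \sum_(k <= i < N) xv i ^+ j.+1.
Proof. exact: sb_pv. Qed.

Lemma realizeM_cst k N a : realizeM k N (cst a) = cst a.
Proof. exact: sbC. Qed.

Local Opaque realizeM.

Lemma realizeM_elem n M k : realizeM n (n + M) (elem k) = symE xv n M k.
Proof.
have L : newton (fun j => (-1) ^+ j * \sum_(n <= i < n + M) xv i ^+ j.+1)
    (realizeM n (n + M) \o elem).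
  apply: newton_ext (newton_rmorph (realizeM n (n + M)) newton_elem) => j /=.
  by rewrite rmorphM rmorphXn rmorphN1 realizeM_pv.
exact: (newton_uniq tf_Pol L (newton_symE xv n M) k).
Qed.

Lemma realizeM_elems n M rho :
  realizeM n (n + M) (elems rho) = \sum_(b <- cs M rho) xsh xv n b.
Proof.
rewrite -symE_prod /elems rmorph_prod; apply: eq_bigr => k _; exact: realizeM_elem.
Qed.

Lemma realizeM_xsh k N n v : realizeM k N (xsh xv n v) = xsh xv n v.
Proof.
elim: v n => [|a v IH] n /=; first exact: rmorph1.
by rewrite rmorphM rmorphXn realizeM_xv IH.
Qed.

Definition xe (k : seq nat * seq nat) : Pol := xsh xv 0 k.1 * elems k.2.

Lemma realizeM_xe n M k : size k.1 = n ->
  realizeM n (n + M) (xe k) = \sum_(b <- cs M k.2) xsh xv 0 (k.1 ++ b).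
Proof.
move=> sk; rewrite /xe rmorphM realizeM_xsh realizeM_elems mulr_sumr.
by apply: eq_bigr => b _; rewrite xsh_cat sk add0n.
Qed.

Definition monP (g : seq nat) (m : cmonom Var) :=
  forall u, m u = if u is inl i then nth 0%N g i else 0%N.

Lemma xsh_mono g : exists2 m, monP g m & xsh xv 0 g = << m >>.
Proof.
pose e (v : Var) := if v is inl i then nth 0%N g i else 0%N.
have [m E hm] := mono_prod [seq inl i : Var | i <- iota 0 (size g)] e.
exists m => [u|].
  rewrite hm big_map; case: u => [i|j]; last first.
    by rewrite big1 // => i _; rewrite muln0.
  have [ig|gi] := ltnP i (size g); last first.
    rewrite nth_default // big_seq big1 // => j.
    rewrite mem_iota add0n => /andP[_ jg].
    by case: eqP => [[E']|]; rewrite ?muln0 //; move: jg; rewrite E'; lia.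
  rewrite (bigD1_seq i) ?iota_uniq ?mem_iota //= eqxx muln1 big1 ?addn0 // => j.
  by move/negPf => ji; rewrite (inj_eq (@inl_inj _ _)) ji muln0.
rewrite -E big_map xsh_prod.
rewrite -(big_mkord xpredT (fun i => xv (0 + i) ^+ nth 0%N g i)).
by rewrite /index_iota subn0.
Qed.

Lemma monP_uniq g m m' : monP g m -> monP g m' -> m = m'.
Proof. by move=> h h'; apply/eqP/cmP => u; rewrite h h'. Qed.

Lemma monP_expvec g m : monP g m -> expvec (size g) m = g.
Proof.
move=> h; apply: (@eq_from_nth _ 0%N); rewrite size_map size_iota // => i ig.
by rewrite (nth_map 0%N) ?size_iota // nth_iota // h.
Qed.

Lemma mcoeff_xsh b g m : size b = size g -> monP g m ->
  (xsh xv 0 b)@_m = (b == g)%:R.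
Proof.
move=> sbg hm; have [m' hm' ->] := xsh_mono b; rewrite mcoeffU1.
have [E|ne] := eqVneq b g.
  by move: hm'; rewrite E => /monP_uniq/(_ hm) ->; rewrite eqxx.
case: eqP => [E|_]; last by [].
case/eqP: ne.
by rewrite -(monP_expvec hm') sbg E monP_expvec.
Qed.

Lemma mcoeff_sumE (I : Type) (r : seq I) (G : I -> Pol) m :
  (\sum_(i <- r) G i)@_m = \sum_(i <- r) (G i)@_m.
Proof. exact: (raddf_sum (mcoeff m)). Qed.

Lemma mcoeff_cst a (f : Pol) m : (cst a * f)@_m = a * f@_m.
Proof. exact: mcoeffCM. Qed.

Lemma sumn_count_mem (T : eqType) (x : T) (s : seq T) :
  (\sum_(b <- s) (b == x))%N = count_mem x s.
Proof. by rewrite -sum1_count [RHS]big_mkcond. Qed.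

(* Look at the coefficient of x^(alpha, top rho) for an offending key (alpha, rho)
   of maximal weight: by [top_in_cs] no other key contributes to it. *)
Lemma triangular n M (S : seq (seq nat * seq nat)) (c : seq nat * seq nat -> F)
    (good : nat -> nat -> bool) :
  uniq S ->
  (forall k, k \in S -> [/\ size k.1 = n, is_partition k.2 &
                            all (fun j => j <= M)%N k.2]) ->
  (forall d w w', (w' <= w)%N -> good d w -> good d w') ->
  (forall g m, size g = (n + M)%N -> monP g m ->
     (realizeM n (n + M) (\sum_(k <- S) cst (c k) * xe k))@_m != 0 ->
     good (sumn g) (N2 g)) ->
  forall k, k \in S -> c k != 0 ->
    good (sumn k.1 + sumn k.2)%N (N2 k.1 + wt k.2)%N.
Proof.
move=> uS hS gmono hg.
pose W (k : seq nat * seq nat) := (N2 k.1 + wt k.2)%N.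
(* A crude bound for all weights: induction on B - W k runs downward in the weight. *)
pose B := (\sum_(k <- S) W k)%N.
have WB k : k \in S -> (W k <= B)%N.
  by move=> kS; rewrite /B (bigD1_seq k) //= leq_addr.
suff H a k : (B - W k <= a)%N -> k \in S -> c k != 0 ->
    good (sumn k.1 + sumn k.2)%N (W k).
  by move=> k; apply: (H (B - W k)%N).
elim/ltn_ind: a k => a IH k ka kS ck.
have [sk pk Mk] := hS k kS.
apply: contraT => bad.
pose g := k.1 ++ top M k.2.
have sg : size g = (n + M)%N by rewrite size_cat sk top_size.
have [m hm _] := xsh_mono g.
have gE : sumn g = (sumn k.1 + sumn k.2)%N.
  by rewrite sumn_cat (sumn_cs (top_cs Mk)).
have gW : N2 g = W k by rewrite N2_cat N2_top.
suff : (realizeM n (n + M) (\sum_(k <- S) cst (c k) * xe k))@_m != 0.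
  by move/(hg g m sg hm); rewrite gE gW (negPf bad).
have coefE k' : k' \in S -> (realizeM n (n + M) (cst (c k') * xe k'))@_m =
    c k' * \sum_(b <- cs M k'.2) (k'.1 ++ b == g)%:R.
  move=> k'S; have [sk' _ _] := hS k' k'S.
  rewrite rmorphM realizeM_cst mcoeff_cst realizeM_xe // mcoeff_sumE; congr (_ * _).
  apply: eq_big_seq => b hb; apply: mcoeff_xsh hm.
  by rewrite sg size_cat sk' (cs_size hb).
have -> : (realizeM n (n + M) (\sum_(k <- S) cst (c k) * xe k))@_m =
    \sum_(k' <- S) c k' * \sum_(b <- cs M k'.2) (k'.1 ++ b == g)%:R.
  have -> : realizeM n (n + M) (\sum_(k <- S) cst (c k) * xe k) =
    \sum_(k <- S) realizeM n (n + M) (cst (c k) * xe k) by exact: rmorph_sum.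
  by rewrite mcoeff_sumE; apply: eq_big_seq.
have Z : \sum_(k' <- S | k' != k)
    c k' * \sum_(b <- cs M k'.2) (k'.1 ++ b == g)%:R = 0 :> F.
  rewrite big_seq_cond big1 // => k' /andP[k'S /= k'k].
  have [->|ck'] := eqVneq (c k') 0; first by rewrite mul0r.
  rewrite big_seq big1 ?mulr0 // => b hb.
  case: eqP => [E|_]; last by [].
  have [sk' pk' Mk'] := hS k' k'S.
  move/eqP: E; rewrite (eqseq_cat _ _ (etrans sk' (esym sk))) => /andP[/eqP E1 /eqP E2].
  rewrite E2 in hb; have [le eqt] := top_in_cs Mk Mk' hb.
  have [Ew|Ew] := eqVneq (wt k.2) (wt k'.2).
    have := top_inj pk pk' Mk Mk' (eqt Ew) => E3.
    by case/eqP: k'k; apply/eqP; rewrite -pair_eqE /= /pair_eq E1 E3 !eqxx.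
  (* A contributing key of larger weight is good by induction and has the degree of k; downward
     closure would then make k good. *)
  have lt : (W k < W k')%N by rewrite /W E1 ltn_add2l ltn_neqAle Ew.
  have Bk' := WB _ k'S.
  have := IH (B - W k')%N _ k' (leqnn _) k'S ck'.
  rewrite E1 -(sumn_cs hb) (sumn_cs (top_cs Mk)) => good'.
  have lta := leq_trans (ltn_sub2l (leq_trans lt Bk') lt) ka.
  by case/negP: bad; apply: gmono (good' lta); apply: ltnW.
have -> : \sum_(k' <- S) c k' * \sum_(b <- cs M k'.2) (k'.1 ++ b == g)%:R =
    c k * \sum_(b <- cs M k.2) (k.1 ++ b == g)%:R.
  by rewrite (bigD1_seq k kS uS) -[RHS]addr0; congr (_ + _); exact: Z.
apply: (mulf_neq0 ck).
rewrite (eq_bigr (fun b => (b == top M k.2)%:R)) => [|b _]; last first.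
  by rewrite (eqseq_cat _ _ (erefl _)) eqxx.
(* What remains is the multiplicity of a monomial in e_rho, a positive integer and hence nonzero in
   F. *)
rewrite -natr_sum sumn_count_mem.
have : (0 < count_mem (top M k.2) (cs M k.2))%N.
  by rewrite -has_count has_pred1; apply: top_cs.
by move/prednK => <-; exact: natF_neq0.
Qed.

(** * t-adic limits *)

Lemma fraction_frac (R : idomainType) (x : {fraction R}) :
  exists2 ab : R * R, ab.2 != 0 & x = tofrac ab.1 / tofrac ab.2.
Proof.
elim/quotW: x => r; exists (frac r); first exact: denom_ratioP.
have d0 : tofrac (frac r).2 != 0 :> {fraction R} by rewrite tofrac_eq0 denom_ratioP.
apply: (canRL (mulfK d0)).
rewrite -[LHS]/(FracField.mul _ _) !piE; apply/eqmodP.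
rewrite /= FracField.equivfE /FracField.mulf.
by rewrite !numden_Ratio ?(oner_eq0, mulf_neq0, denom_ratioP) // !mulr1 mulrC.
Qed.

Section Valuation.
Context (R : idomainType) (K : fieldType) (tau : {rmorphism {poly R} -> K}).
Hypothesis tau_eq0 : forall p, (tau p == 0) = (p == 0).
Hypothesis frac_tau : forall x : K,
  exists2 ab : {poly R} * {poly R}, ab.2 != 0 & x = tau ab.1 / tau ab.2.

(** The condition [tval_ge] over an abstract fraction field of R[t], so that the concrete field
    stays folded. *)
Definition tvge (x : K) (N : nat) : Prop :=
  exists n d : {poly R},
    d`_0 != 0 /\ x = tau n / tau d /\ (forall i, (i < N)%N -> n`_i = 0).

Lemma X_adic (p : {poly R}) : p != 0 ->
  exists s (q : {poly R}), q`_0 != 0 /\ p = q * 'X^s.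
Proof.
move=> p0; have [s [q hq E]] := multiplicity_XsubC p 0.
rewrite p0 /= in hq; exists s, q; rewrite -horner_coef0; split=> //.
by rewrite {1}E subr0.
Qed.

Lemma tau_neq0 (p : {poly R}) : p != 0 -> tau p != 0.
Proof. by rewrite tau_eq0. Qed.

Lemma coef0_neq0 (d : {poly R}) : d`_0 != 0 -> d != 0.
Proof. by apply: contra_neq => ->; rewrite coef0. Qed.

Lemma tvge0 N : tvge 0 N.
Proof.
exists 0, 1; split; first by rewrite coef1 oner_neq0.
by split=> [|i _]; rewrite ?(rmorph0 tau) ?mul0r ?coef0.
Qed.

Lemma tvgeD x y N : tvge x N -> tvge y N -> tvge (x + y) N.
Proof.
move=> [n [d [d0 [-> hn]]]] [n' [d' [d0' [-> hn']]]].
exists (n * d' + n' * d), (d * d'); split.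
  by rewrite coefM big_ord1 mulf_neq0.
have h := tau_neq0 (coef0_neq0 d0); have h' := tau_neq0 (coef0_neq0 d0').
split=> [|i iN].
  by rewrite (rmorphD tau) !(rmorphM tau) addf_div.
rewrite coefD !coefM !big1 ?addr0 // => -[j ji] _ /=; rewrite ?hn ?hn' ?mul0r //;
  exact: leq_ltn_trans (ji : (j <= i)%N) iN.
Qed.

(** The loss s is the power of t dividing the denominator of G. *)
Lemma tvgeM (G : K) : exists s, forall x N, tvge x (N + s) -> tvge (x * G) N.
Proof.
have [[a b] /= b0 ->] := frac_tau G; have [s [b' [b0' Eb]]] := X_adic b0.
exists s => x N [n [d [d0 [-> hn]]]].
have En : n = drop_poly s n * 'X^s.
  rewrite -{1}[n](poly_take_drop s).
  have -> : take_poly s n = 0 :> {poly R}.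
    apply/polyP => i; rewrite coef_take_poly coef0; case: ltnP => // h.
    by apply: hn; apply: leq_trans h (leq_addl _ _).
  by rewrite add0r.
exists (drop_poly s n * a), (d * b'); split.
  by rewrite coefM big_ord1 mulf_neq0.
have hd := tau_neq0 (coef0_neq0 d0); have hb := tau_neq0 (coef0_neq0 b0').
have hX : tau ('X^s : {poly R}) != 0 by apply: tau_neq0; rewrite monic_neq0 ?monicXn.
split=> [|i iN].
  rewrite {1}En Eb !(rmorphM tau); field; by rewrite hd hb hX.
rewrite coefM big1 // => -[j ji] _ /=; rewrite coef_drop_poly hn ?mul0r //.
by rewrite ltn_add2r; apply: leq_ltn_trans iN.
Qed.

(** If x = a/b with t^s exactly dividing a, then x = n/d with t^(s+1) dividing n contradicts a d = n
    b at the coefficient of t^s. *)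
Lemma tvge_eq0 (x : K) : (forall N, tvge x N) -> x = 0.
Proof.
have [[a b] /= b0 ->] := frac_tau x => h.
have [->|a0] := eqVneq a 0; first by rewrite (rmorph0 tau) mul0r.
have [s [a' [a0' Ea]]] := X_adic a0.
have [n [d [d0 [E hn]]]] := h s.+1.
have hd := tau_neq0 (coef0_neq0 d0); have hb := tau_neq0 b0.
move/eqP: E; rewrite eqr_div // -!(rmorphM tau) -subr_eq0 -(rmorphB tau) tau_eq0 subr_eq0 => /eqP /(congr1 (fun p : {poly R} => p`_s)).
rewrite Ea mulrAC coefMXn ltnn subnn coefM big_ord1 [in RHS]coefM big1 => [/eqP|[j js] _ /=].
  by rewrite mulf_eq0 (negPf a0') (negPf d0).
by rewrite hn // mul0r.
Qed.

End Valuation.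

Local Transparent F.

Lemma F_frac (x : F) : exists2 ab : {poly {poly rat}} * {poly {poly rat}},
  ab.2 != 0 & x = tofrac ab.1 / tofrac ab.2.
Proof. exact: fraction_frac. Qed.

Definition tofracM : {rmorphism {poly {poly rat}} -> F} := @tofrac {poly {poly rat}}.

Lemma tofracM_eq0 p : (tofracM p == 0) = (p == 0).
Proof. exact: tofrac_eq0. Qed.

Lemma tval_geE x N : tval_ge x N = tvge tofracM x N.
Proof. by []. Qed.

Local Opaque F tofracM tval_ge.

Lemma tconv_lin r (a : 'I_r -> nat -> F) (al G : 'I_r -> F) (v : F) M :
  (forall i, tconv (a i) (al i)) ->
  (forall m, (M <= m)%N -> \sum_i a i m * G i = v) ->
  \sum_i al i * G i = v.
Proof.
move=> ha hv; apply/eqP; rewrite eq_sym -subr_eq0; apply/eqP.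
apply: (tvge_eq0 tofracM_eq0 F_frac) => N; rewrite -tval_geE.
have hi (i : 'I_r) : exists Mi, forall m, (Mi <= m)%N ->
    tval_ge ((a i m - al i) * G i) N.
  have [s hs] := tvgeM tofracM_eq0 F_frac (G i); have [Mi hMi] := ha i (N + s)%N.
  by exists Mi => m /hMi; rewrite !tval_geE => /hs.
have [Ms hMs] := fin_all_exists hi.
(* The sum of the thresholds serves as a common upper bound for them. *)
pose m := (M + \sum_i Ms i)%N.
rewrite -(hv m (leq_addr _ _)) -sumrB.
elim/big_ind: _ => [|x y|i _]; [exact: (tvge0 tofracM)|rewrite !tval_geE; exact: (tvgeD tofracM_eq0)|].
rewrite -mulrBl; apply: hMs; rewrite /m (bigD1 i) //=; lia.
Qed.

(** * Symmetrization *)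

Section NewtonSolve.
Context (P : comNzRingType).

Lemma newton_solve_a (c a : nat -> P) s k : newton c a -> s * k.+1%:R = 1 ->
  a k.+1 = s * \sum_(j < k.+1) c j * a (k - j)%N.
Proof. by move=> [_ aS] sk; rewrite -aS -mulr_natl mulrA sk mul1r. Qed.

Lemma newton_solve_c (p a s : nat -> P) k :
  newton (fun j => s j * p j) a -> (forall j, s j * s j = 1) ->
  p k = s k * (k.+1%:R * a k.+1 - \sum_(j < k) s j * (p j * a (k - j)%N)).
Proof.
move=> [a0 aS] ss; rewrite mulr_natl aS big_ord_recr /= subnn a0 mulr1.
rewrite [X in X - _](_ : _ = \sum_(j < k) s j * (p j * a (k - j)%N) + s k * p k).
  by rewrite addrAC subrr add0r mulrA ss mul1r.
by congr (_ + _); apply: eq_bigr => j _; rewrite mulrA.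
Qed.

Lemma iter_mul (A : P -> Prop) x e f :
  (forall g, A g -> A (x * g)) -> A f -> A (x ^+ e * f).
Proof.
move=> h hf; elim: e => [|e IH]; first by rewrite mul1r.
by rewrite exprS -mulrA; apply: h.
Qed.

Lemma xsh_nseq0 (x : nat -> P) n k : xsh x n (nseq k 0%N) = 1.
Proof. by elim: k n => //= k IH n; rewrite IH mulr1. Qed.

Lemma mul_xsh (x : nat -> P) n i al : (i < size al)%N ->
  exists2 al', size al' = size al & x (n + i)%N * xsh x n al = xsh x n al'.
Proof.
elim: al n i => // a al IH n [|i] /= h.
  by exists (a.+1 :: al) => //=; rewrite addn0 exprS mulrA.
have [al' sz E] := IH n.+1 i h; exists (a :: al'); rewrite /= ?sz //.
by rewrite -E addSnnS mulrCA.
Qed.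

End NewtonSolve.

Lemma Fspan_eqmap T (Q : T -> Prop) (g : T -> Pol) L M f :
  Flinear L -> Flinear M -> (forall x, Q x -> L (g x) = M (g x)) ->
  Fspan Q g f -> L f = M f.
Proof.
move=> Ll Ml H; elim=> [|a x u Qx _ IH]; first by rewrite !Flinear0.
by rewrite Ll.1 Ml.1 Ll.2 Ml.2 H // IH.
Qed.

Lemma FspanM T (Q : T -> Prop) (g : T -> Pol) f f' :
  (forall x y, Q x -> Q y -> Fspan Q g (g x * g y)) ->
  Fspan Q g f -> Fspan Q g f' -> Fspan Q g (f * f').
Proof.
move=> h + hf'; elim=> [|a x u Qx _ IH]; first by rewrite mul0r; left.
rewrite mulrDl -mulrA; apply: FspanD IH; apply: FspanZ.
by apply: Fspan_map (mul_lin _) _ hf' => y; apply: h.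
Qed.

(** * Lambda spanned by power sums and by elementary functions *)

Definition pm (mu : seq nat) : Pol := \prod_(j <- mu) pv j.

Lemma pm_cat a b : pm (a ++ b) = pm a * pm b.
Proof. by rewrite /pm big_cat. Qed.

Lemma pm_cons j a : pm (j :: a) = pv j * pm a.
Proof. by rewrite /pm big_cons. Qed.

Lemma pm_nil : pm [::] = 1.
Proof. by rewrite /pm big_nil. Qed.

Lemma elems_cat a b : elems (a ++ b) = elems a * elems b.
Proof. by rewrite /elems big_cat. Qed.

(** Two spans of the same space: [dminus] is computed on monomials in the p_j, whereas the Pieri
    rule and triangularity live on the e_rho. *)
Definition Lam : Pol -> Prop := Fspan (fun=> True) pm.
Definition Elam : Pol -> Prop := Fspan (fun=> True) elems.

Lemma LamM f g : Lam f -> Lam g -> Lam (f * g).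
Proof. by apply: FspanM => a b _ _; rewrite -pm_cat; exact: Fspan_gen. Qed.

Lemma ElamM f g : Elam f -> Elam g -> Elam (f * g).
Proof. by apply: FspanM => a b _ _; rewrite -elems_cat; exact: Fspan_gen. Qed.

Lemma Lam1 : Lam 1.
Proof. by rewrite -pm_nil; exact: Fspan_gen. Qed.

Lemma Elam1 : Elam 1.
Proof. by rewrite -elems_nil; exact: Fspan_gen. Qed.

Lemma Lam_pv j : Lam (pv j).
Proof.
have -> : pv j = pm [:: j] by rewrite /pm big_seq1.
exact: Fspan_gen.
Qed.

Lemma Elam_elem j : Elam (elem j).
Proof.
have -> : elem j = elems [:: j] by rewrite /elems big_seq1.
exact: Fspan_gen.
Qed.

Lemma newton_elem_cst : newton (fun j => cst ((-1) ^+ j) * pv j) elem.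
Proof.
by apply: newton_ext newton_elem => j; rewrite cst_exp cst_opp cst1.
Qed.

Lemma cst_nat n : cst n%:R = n%:R.
Proof. by rewrite cstME (rmorph_nat cstM). Qed.

Lemma Lam_elem k : Lam (elem k).
Proof.
elim/ltn_ind: k => -[|k] IH; first by rewrite elem0; exact: Lam1.
have inv : cst (k.+1%:R^-1) * k.+1%:R = 1.
  by rewrite -cst_nat -cst_mul (mulVf (natF_neq0 k)) cst1.
apply: (Fspan_eq (newton_solve_a newton_elem_cst inv)).
apply: FspanZ; apply: Fspan_sum => j _.
apply: LamM; first by apply: FspanZ; exact: Lam_pv.
by apply: IH; rewrite ltnS leq_subr.
Qed.

Lemma Elam_pv k : Elam (pv k).
Proof.
elim/ltn_ind: k => k IH.
have ss j : cst ((-1) ^+ j) * cst ((-1) ^+ j) = 1.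
  by rewrite -cst_mul -expr2 sqrr_sign cst1.
apply: (Fspan_eq (newton_solve_c k newton_elem_cst ss)).
apply: FspanZ; apply: FspanB.
  by rewrite -cst_nat; apply: FspanZ; exact: Elam_elem.
apply: Fspan_sum => -[j jk] _; apply: FspanZ; apply: ElamM; first exact: IH.
exact: Elam_elem.
Qed.

Lemma Elam_Lam f : Elam f -> Lam f.
Proof.
apply: Fspan_sub => rho _; elim: rho => [|k rho IH].
  by rewrite elems_nil; exact: Lam1.
by rewrite elems_cons; apply: LamM; first exact: Lam_elem.
Qed.

Lemma Lam_Elam f : Lam f -> Elam f.
Proof.
apply: Fspan_sub => rho _; elim: rho => [|k rho IH].
  by rewrite pm_nil; exact: Elam1.
by rewrite pm_cons; apply: ElamM; first exact: Elam_pv.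
Qed.

Lemma elems_norm rho : exists rho',
  [/\ is_partition rho', sumn rho' = sumn rho & elems rho = elems rho'].
Proof.
have geq_tot : total geq by move=> x y; apply: leq_total.
exists (sort geq (filter (fun x => 0 < x)%N rho)); split.
- rewrite /is_partition sort_sorted //=.
  by rewrite all_sort filter_all.
- rewrite (perm_sumn (permEl (perm_sort geq _))).
  by elim: rho => // -[|x] rho /= ->.
rewrite /elems (perm_big _ (permEl (perm_sort geq _))) /=.
elim: rho => // -[|x] rho IH /=; last by rewrite !big_cons IH.
by rewrite big_cons IH elem0 (mul1r (\prod_(k <- _) _)).
Qed.

Lemma Pol_mono_sum (f : Pol) : f = \sum_(m <- msupp f) cst f@_m * << m >>.
Proof.
rewrite {1}[f]monalgE; apply: eq_bigr => m _; apply/malgP => k.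
by rewrite mcoeffU (mcoeff_cst _ << m >>) mcoeffU1 mulr_natr.
Qed.

Definition xpm (k : seq nat * seq nat) : Pol := xsh xv 0 k.1 * pm k.2.

Lemma inPk_span n f : inPk n f -> Fspan (fun k => size k.1 = n) xpm f.
Proof.
move=> hf; apply: (Fspan_eq (Pol_mono_sum f)).
rewrite big_seq; apply: Fspan_sum => m /hf hm; apply: FspanZ.
apply: (Fspan_eq (mono_fold m)).
have {hm} : forall i, inl i \in (finsupp m : seq Var) -> (i < n)%N by [].
elim: (finsupp m : seq Var) => [|v r IH] hr.
  rewrite big_nil; have -> : 1 = xpm (nseq n 0%N, [::]).
    by rewrite /xpm xsh_nseq0 pm_nil mulr1.
  by apply: Fspan_gen; rewrite /= size_nseq.
rewrite big_cons; apply: iter_mul => [g|]; last first.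
  by apply: IH => i ir; apply: hr; rewrite inE ir orbT.
apply: Fspan_map (mul_lin _) _ => -[al mu] /= sal.
case: v hr => [i|j] hr.
  have il : (i < size al)%N by rewrite sal; apply: hr; rewrite inE eqxx.
  have [al' sal' E] := mul_xsh xv 0 il.
  have -> : << ucm (inl i) >> * xpm (al, mu) = xpm (al', mu).
    by rewrite /xpm mulrA; congr (_ * _).
  by apply: Fspan_gen; rewrite /= sal'.
have -> : << ucm (inr j) >> * xpm (al, mu) = xpm (al, j :: mu).
  by rewrite /xpm /= pm_cons mulrCA.
exact: Fspan_gen.
Qed.

Lemma inPk_xe n f : inPk n f ->
  Fspan (fun k => size k.1 = n /\ is_partition k.2) xe f.
Proof.
move/inPk_span; apply: Fspan_sub => -[al mu] /= sal.
have : Elam (pm mu) by apply: Lam_Elam; exact: Fspan_gen.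
apply: Fspan_map (mul_lin _) _ => rho _.
have [rho' [h1 _ h3]] := elems_norm rho.
have -> : xsh xv 0 al * elems rho = xe (al, rho') by rewrite /xe h3.
exact: Fspan_gen.
Qed.

Lemma inLambda_Elam f : inLambda f -> Elam f.
Proof.
move/inPk_xe; apply: Fspan_sub => -[al rho] /= [/size0nil -> _].
have -> : xe ([::], rho) = elems rho by rewrite /xe /= mul1r.
exact: Fspan_gen.
Qed.

Lemma pm_mono mu : exists2 m : cmonom Var, (forall i, m (inl i) = 0%N) & pm mu = << m >>.
Proof.
have [m E hm] := mono_prod [seq inr j : Var | j <- mu] (fun=> 1%N).
exists m => [i|]; first by rewrite hm big_map big1.
by rewrite -E big_map; apply: eq_bigr => j _; rewrite expr1.
Qed.

Lemma Lam_inLambda f : Lam f -> inLambda f.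
Proof.
move=> hf m; rewrite -mcoeff_neq0 => fm i im.
have mi : m (inl i) != 0%N by rewrite cmE_neq0.
move/eqP: fm; case; elim: hf => [|a mu u _ _ IH]; first exact: mcoeff0.
have [m' hm' ->] := pm_mono mu.
rewrite mcoeffD (mcoeff_cst a << m' >>) IH mcoeffU1 addr0.
case: eqP => [E|_]; last by rewrite mulr0.
by move: mi; rewrite -E hm'.
Qed.

(** * The operators partial_- and the symmetrization *)

Definition dterm k (m : cmonom Var) : Pol :=
  xpart k m * Jing (m (inl k.-1)) (ppart m).

(** A sum over the support of f does not show additivity; [mmap] presents it as the linear extension
    of [dterm]. *)
Lemma dminusE k f : dminus k f = mmap cstM (dterm k) f.
Proof. by apply: eq_bigr => m _; exact: Pol_scale. Qed.

Lemma dminus_lin k : Flinear (dminus k).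
Proof.
split=> [f g|a f]; rewrite !dminusE; first exact: mmapD.
apply: etrans (congr1 (mmap cstM (dterm k)) (esym (Pol_scale a f))) _.
apply: (etrans (mmapEw (msuppZ_le a f))).
apply: etrans _ (esym (mulr_sumr _ _ _ _)); apply: eq_bigr => m _.
rewrite mcoeffZ.
apply: etrans (congr1 (fun z => z * dterm k m) (rmorphM cstM a f@_m)) _.
exact: esym (mulrA _ _ _).
Qed.

Lemma dminus_mono k m : dminus k << m >> = dterm k m.
Proof.
rewrite dminusE; transitivity (cstM 1 * dterm k m); first exact: mmapU.
by rewrite (rmorph1 cstM) (mul1r (dterm k m)).
Qed.

Definition ppartM : {rmorphism Pol -> Pol} :=
  sb cstM (fun v => match v with inl _ => 1 | inr j => pv j end).

Definition xpartM k : {rmorphism Pol -> Pol} :=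
  sb cstM (fun v => match v with
                    | inl i => if i == k.-1 then 1 else xv i
                    | inr _ => 1
                    end).

Lemma ppartE m : ppart m = ppartM << m >>.
Proof.
rewrite sb_mono; apply: eq_bigr => -[i|j] _; last by [].
by rewrite expr1n.
Qed.

Lemma xpartE k m : xpart k m = xpartM k << m >>.
Proof.
rewrite sb_mono; apply: eq_bigr => -[i|j] _; last by rewrite expr1n.
by case: eqP => // _; rewrite expr1n.
Qed.

Lemma ppartM_pm mu : ppartM (pm mu) = pm mu.
Proof. by rewrite rmorph_prod; apply: eq_bigr => j _; exact: sb_pv. Qed.

Lemma xpartM_pm k mu : xpartM k (pm mu) = 1.
Proof. by rewrite rmorph_prod big1 // => j _; exact: sb_pv. Qed.

Lemma ppartM_xsh n al : ppartM (xsh xv n al) = 1.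
Proof.
elim: al n => [|a al IH] n /=; first exact: rmorph1.
by rewrite rmorphM rmorphXn sb_xv expr1n mul1r IH.
Qed.

Lemma xpartM_xv k i : xpartM k.+1 (xv i) = if i == k then 1 else xv i.
Proof. exact: sb_xv. Qed.

Local Opaque xpartM ppartM.

Lemma xpartM_xsh k n al : (n + size al <= k)%N ->
  xpartM k.+1 (xsh xv n al) = xsh xv n al.
Proof.
elim: al n => [|a al IH] n /= h; first exact: rmorph1.
have nk : (n < k)%N by apply: leq_trans h; rewrite addnS ltnS leq_addr.
by rewrite rmorphM rmorphXn xpartM_xv (ltn_eqF nk) (IH n.+1) // addSnnS.
Qed.

Lemma dminus_xpm n al a mu : size al = n ->
  dminus n.+1 (xsh xv 0 (rcons al a) * pm mu) = xsh xv 0 al * Jing a (pm mu).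
Proof.
move=> sal; have [m hm Em] := xsh_mono (rcons al a).
have [m' hm' Em'] := pm_mono mu.
have Emm : << mulcm m m' >> = xsh xv 0 (rcons al a) * pm mu.
  by rewrite Em Em' monoM.
have e1 : mulcm m m' (inl n) = a.
  by rewrite mulcmE hm hm' addn0 /= nth_rcons sal ltnn eqxx.
have e2 : ppart (mulcm m m') = pm mu.
  by rewrite ppartE Emm (rmorphM ppartM) ppartM_xsh ppartM_pm (mul1r (pm mu)).
have x1 : xpartM n.+1 (xsh xv n [:: a]) = 1.
  by rewrite /= mulr1 rmorphXn xpartM_xv eqxx expr1n.
have e3 : xpart n.+1 (mulcm m m') = xsh xv 0 al.
  rewrite xpartE Emm (rmorphM (xpartM n.+1)) xpartM_pm -cats1 xsh_cat.
  by rewrite (rmorphM (xpartM n.+1)) add0n sal x1 !mulr1 xpartM_xsh // sal.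
rewrite -Emm dminus_mono.
exact: (f_equal2 (fun x y => x * y) e3 (f_equal2 Jing e1 e2)).
Qed.

Lemma Lam_Jing a f : Lam f -> Lam (Jing a f).
Proof.
move=> /Lam_Elam hf; apply: Elam_Lam; apply: Fspan_map (Jing_lin a) _ hf => rho _.
by apply: Fspan_imp (Jing_elems_span a rho).
Qed.

Lemma dminus_xsh n al a f : size al = n -> Lam f ->
  dminus n.+1 (xsh xv 0 (rcons al a) * f) = xsh xv 0 al * Jing a f.
Proof.
move=> sal hf.
apply: (Fspan_eqmap (comp_lin (dminus_lin n.+1) (mul_lin (xsh xv 0 (rcons al a))))
  (comp_lin (mul_lin (xsh xv 0 al)) (Jing_lin a)) _ hf) => mu _.
exact: dminus_xpm.
Qed.

Lemma sigmaTS n f : sigmaT n.+1 f = sigmaT n (dminus n.+1 f).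
Proof. by []. Qed.

Local Opaque dminus.

Lemma sigmaT_xsh n al f : size al = n -> Lam f ->
  sigmaT n (xsh xv 0 al * f) = Jings al f.
Proof.
elim: n al f => [|n IH] al f; first by move/size0nil => -> _; exact: mul1r.
(* Variables are removed from the last one, so B of the last exponent acts first. *)
case/lastP: al => // al a; rewrite size_rcons => -[sal] hf.
rewrite sigmaTS (dminus_xsh _ sal hf) (IH _ _ sal (Lam_Jing a hf)).
by rewrite -cats1 Jings_cat.
Qed.

Lemma sigmaT_lin n : Flinear (sigmaT n).
Proof.
elim: n => [|n IH]; first by split.
exact: (comp_lin IH (dminus_lin n.+1)).
Qed.

(** * The basis *)

Section FiniteSums.
Context (K : fieldType) (P : comNzRingType) (ka : {rmorphism K -> P}).

Lemma sum_delta (T : eqType) (S : seq T) x (G : T -> P) : uniq S -> x \in S ->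
  \sum_(y <- S) ka (y == x)%:R * G y = G x.
Proof.
move=> uS xS; rewrite (bigD1_seq x) //= eqxx rmorph1 mul1r big1 ?addr0 // => y.
by move/negPf => ->; rewrite rmorph0 mul0r.
Qed.

Lemma sum_comb (T : Type) r (S : seq T) (b : 'I_r -> K) (c : 'I_r -> T -> K)
    (G : T -> P) :
  \sum_i ka (b i) * \sum_(y <- S) ka (c i y) * G y =
  \sum_(y <- S) ka (\sum_i b i * c i y) * G y.
Proof.
under eq_bigr do rewrite mulr_sumr.
rewrite exchange_big /=; apply: eq_bigr => y _.
rewrite rmorph_sum mulr_suml; apply: eq_bigr => i _.
by rewrite rmorphM mulrA.
Qed.

Lemma sum_subr (T : Type) (S : seq T) (c d : T -> K) (G : T -> P) :
  \sum_(y <- S) ka (c y - d y) * G y =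
  \sum_(y <- S) ka (c y) * G y - \sum_(y <- S) ka (d y) * G y.
Proof. by rewrite -sumrB; apply: eq_bigr => y _; rewrite rmorphB mulrBl. Qed.

Lemma sum_addr (T : Type) (S : seq T) (c d : T -> K) (G : T -> P) :
  \sum_(y <- S) ka (c y + d y) * G y =
  \sum_(y <- S) ka (c y) * G y + \sum_(y <- S) ka (d y) * G y.
Proof. by rewrite -big_split; apply: eq_bigr => y _; rewrite rmorphD mulrDl. Qed.

Lemma sum_scale (T : Type) (S : seq T) a (d : T -> K) (G : T -> P) :
  \sum_(y <- S) ka (a * d y) * G y = ka a * \sum_(y <- S) ka (d y) * G y.
Proof. by rewrite mulr_sumr; apply: eq_bigr => y _; rewrite rmorphM mulrA. Qed.

Lemma sum_restrict (T : eqType) (S R : seq T) (c : T -> K) (G : T -> P) :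
  uniq S -> uniq R -> {subset S <= R} ->
  \sum_(y <- R) ka (if y \in S then c y else 0) * G y =
  \sum_(y <- S) ka (c y) * G y.
Proof.
move=> uS uR sub.
have /(perm_big _) <- : perm_eq [seq y <- R | y \in S] S.
  apply: uniq_perm; rewrite ?filter_uniq // => y.
  by rewrite mem_filter andb_idr // => /sub.
rewrite big_filter [RHS]big_mkcond; apply: eq_bigr => y _.
by case: ifP => // _; rewrite rmorph0 mul0r.
Qed.

(** Freeness of u turns the two expansions into A B = 1. The matrices are square, so B A = 1 as
    well, and a relation c on v gives c B = 0, hence c = c B A = 0. *)
Lemma free_transfer N (u v : 'I_N -> P) (A B : 'M[K]_N) :
  (forall i, u i = \sum_j ka (A i j) * v j) ->
  (forall i, v i = \sum_j ka (B i j) * u j) ->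
  (forall c : 'I_N -> K, \sum_k ka (c k) * u k = 0 -> forall k, c k = 0) ->
  forall c : 'I_N -> K, \sum_k ka (c k) * v k = 0 -> forall k, c k = 0.
Proof.
move=> hu hv iu.
have AB : A *m B = 1%:M.
  apply/matrixP => i k; apply/eqP; rewrite -subr_eq0; apply/eqP; move: k.
  apply: (iu (fun k => (A *m B) i k - (1%:M : 'M[K]_N) i k)).
  rewrite sum_subr [X in _ - X](_ : _ = u i); last first.
    rewrite -[RHS](@sum_delta _ (index_enum 'I_N) i u) ?index_enum_uniq ?mem_index_enum //.
    by apply: eq_bigr => k _; rewrite mxE eq_sym.
  rewrite [X in X - _](_ : _ = u i) ?subrr // hu.
  under [RHS]eq_bigr do rewrite hv.
  by rewrite sum_comb; apply: eq_bigr => k _; rewrite mxE.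
have BA := mulmx1C AB.
move=> c hc k.
have cB : (\row_j c j) *m B = 0.
  apply/rowP => j; rewrite mxE [RHS]mxE; move: j.
  apply: (iu (fun j => \sum_i (\row_j c j) 0 i * B i j)).
  rewrite -sum_comb -[RHS]hc; apply: eq_bigr => j _; by rewrite mxE -hv.
have := congr1 (fun X : 'rV[K]_N => (X *m A) 0 k) cB.
by rewrite mul0mx -mulmxA BA mulmx1 !mxE.
Qed.

End FiniteSums.

(** The coefficients are valid over every larger duplicate-free list, so that several combinations
    can be put over one common list. *)
Lemma Fspan_list (T : eqType) (Q : T -> Prop) (g : T -> Pol) f : Fspan Q g f ->
  exists sc : seq T * (T -> F), (forall x, x \in sc.1 -> Q x) /\
    forall S, uniq S -> {subset sc.1 <= S} -> f = \sum_(x <- S) cst (sc.2 x) * g x.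
Proof.
elim=> [|a x u Qx _ [[s c] /= [hs hc]]].
  exists ([::], fun=> 0); split=> //= S _ _.
  by rewrite big1 // => y _; rewrite cst0 mul0r.
exists (x :: s, fun y => a * (y == x)%:R + c y); split=> [y|S uS sub] /=.
  by rewrite inE => /predU1P[->|/hs].
have xS : x \in S by apply: sub; rewrite inE eqxx.
have hu := hc S uS (fun y ys => sub y (mem_behead (s := x :: s) ys)).
apply: esym; apply: (etrans (sum_addr cstM S (fun y => a * (y == x)%:R) c g)).
apply: (f_equal2 (fun p q => p + q)) (esym hu).
apply: (etrans (sum_scale cstM S a (fun y => (y == x)%:R) g)).
exact: (congr1 (fun p => cst a * p) (sum_delta cstM g uS xS)).
Qed.

Lemma Fspan_seq (T : eqType) (R : seq T) (g : T -> Pol) f : uniq R ->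
  Fspan (fun x => x \in R) g f ->
  exists c : T -> F, f = \sum_(x <- R) cst (c x) * g x.
Proof. by move=> uR /Fspan_list[[s c] [/= hs hc]]; exists c; apply: hc. Qed.

Lemma free_transfer_seq (T : eqType) (R : seq T) (u v : T -> Pol) : uniq R ->
  (forall c : T -> F, \sum_(x <- R) cst (c x) * u x = 0 ->
     forall x, x \in R -> c x = 0) ->
  (forall x, x \in R -> Fspan (fun y => y \in R) v (u x)) ->
  (forall x, x \in R -> Fspan (fun y => y \in R) u (v x)) ->
  forall c : T -> F, \sum_(x <- R) cst (c x) * v x = 0 ->
     forall x, x \in R -> c x = 0.
Proof.
move=> uR iu huv hvu c hc x xR.
pose t := in_tuple R; pose N := size R.
have tR (i : 'I_N) : tnth t i \in R by exact: mem_tnth.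
have toord (h : T -> Pol) (d : T -> F) :
    \sum_(y <- R) cst (d y) * h y = \sum_(i < N) cst (d (tnth t i)) * h (tnth t i).
  exact: big_tnth.
have mx (w z : T -> Pol) : (forall y, y \in R -> Fspan (fun y => y \in R) z (w y)) ->
    exists A : 'M[F]_N, forall i, w (tnth t i) = \sum_j cst (A i j) * z (tnth t j).
  move=> h.
  have /fin_all_exists[C hC] : forall i : 'I_N, exists d : T -> F,
      w (tnth t i) = \sum_(y <- R) cst (d y) * z y.
    by move=> i; apply: Fspan_seq => //; apply: h.
  exists (\matrix_(i, j) C i (tnth t j)) => i; rewrite hC toord.
  by apply: eq_bigr => j _; rewrite mxE.
have [A hA] := mx _ _ huv; have [B hB] := mx _ _ hvu.
have iu' (d : 'I_N -> F) : \sum_k cst (d k) * u (tnth t k) = 0 -> forall k, d k = 0.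
  pose d' y := if insub (index y R) is Some i then d i else 0.
  have d'E i : d' (tnth t i) = d i.
    have ii : index (tnth t i) R = val i by rewrite (tnth_nth x) index_uniq.
    by rewrite /d' ii valK.
  move=> hd k; rewrite -d'E; apply: iu (tR k); rewrite toord -[RHS]hd.
  by apply: eq_bigr => i _; rewrite d'E.
have xi : (index x R < N)%N by rewrite index_mem.
have -> : x = tnth t (Ordinal xi) by rewrite (tnth_nth x) nth_index.
apply: (free_transfer (ka := cstM) hA hB iu' (c := fun k => c (tnth t k))).
by rewrite -[RHS]hc toord.
Qed.

(** * The shape of the limit polynomials *)

Lemma sorted_geq_cat0 la m : is_partition la -> sorted geq (la ++ nseq m 0%N).
Proof.
case/andP=> sla _; elim: la sla => [|x la IH] /=.
  by move=> _; elim: m => // -[|m].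
case: la IH => [|y la] IH /=; last by case/andP=> -> /IH.
by move=> _; case: m {IH} => //= m; elim: m.
Qed.

Lemma sorted_strip ka : sorted geq ka ->
  exists la r, is_partition la /\ ka = la ++ nseq r 0%N.
Proof.
elim: ka => [|x ka IH] sx; first by exists [::], 0%N.
have [la [r [pla E]]] := IH (path_sorted sx).
case: x sx => [|x] sx; last first.
  exists (x.+1 :: la), r; split; last by rewrite E.
  move: sx pla; rewrite E /is_partition /=.
  by case: la {E} => //= y la /andP[-> _].
exists [::], (size ka).+1; split=> //=; congr (_ :: _).
have : path geq 0%N ka by [].
elim: ka {IH sx E} => //= y ka IH /andP[]; rewrite /geq /= leqn0 => /eqP -> h.
by rewrite {1}IH.
Qed.

Definition lower_key (la : seq nat) (k : seq nat * seq nat) :=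
  [/\ size k.1 = size la, is_partition k.2, (sumn k.1 + sumn k.2 = sumn la)%N &
      (N2 k.1 + wt k.2 < N2 la)%N].

Lemma xmonoE nu : xmono nu = xsh xv 0 nu.
Proof. by rewrite xsh_prod. Qed.

Lemma xe_nil la : xe (la, [::]) = xsh xv 0 la.
Proof. by rewrite /xe elems_nil; exact: mulr1. Qed.

Lemma realizeM_sum (n N : nat) (T : Type) (S : seq T) (c : T -> F) (g : T -> Pol) :
  realizeM n N (\sum_(x <- S) cst (c x) * g x) = \sum_(x <- S) cst (c x) * realizeM n N (g x).
Proof.
apply: (etrans (rmorph_sum (realizeM n N) _ _ _)); apply: eq_bigr => x _.
by rewrite (rmorphM (realizeM n N)) realizeM_cst.
Qed.

Lemma scale_sum r (b : 'I_r -> F) (g : 'I_r -> Pol) :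
  \sum_(i < r) b i *: g i = \sum_(i < r) cst (b i) * g i.
Proof. by apply: eq_bigr => i _; exact: Pol_scale. Qed.

Lemma xsh_pad la m : xsh xv 0 (la ++ nseq m 0%N) = xsh xv 0 la.
Proof. by rewrite xsh_cat xsh_nseq0; exact: mulr1. Qed.

Lemma nsMac_coef nu E g m : is_nsMac nu E -> sorted geq nu ->
  size g = size nu -> monP g m -> (E - xsh xv 0 nu)@_m != 0 ->
  sumn g = sumn nu /\ (N2 g < N2 nu)%N.
Proof.
move=> [_ [hlow _]] snu sg hm; rewrite mcoeff_neq0 -xmonoE => /hlow.
by rewrite -sg (monP_expvec hm); exact: bruhat_lt_N2.
Qed.

Lemma limit_form (E Et : seq nat -> Pol) la :
  (forall nu, is_nsMac nu (E nu)) -> is_partition la ->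
  IWconv (size la) (fun m => E (la ++ nseq m 0%N)) (Et la) ->
  exists2 f, Fspan (lower_key la) xe f & Et la = xsh xv 0 la + f.
Proof.
move=> hE pla [r [g [a [al [hg [ha [[M0 hM] ->]]]]]]].
pose n := size la; pose k0 : seq nat * seq nat := (la, [::]).
have /fin_all_exists[sc hsc] := fun i => Fspan_list (inPk_xe (hg i)).
(* One list of keys for all g_i and for x^la, independent of m: the vanishing of a coefficient
   becomes a fixed linear equation in the scalars a_i(m). *)
pose S := undup (k0 :: flatten [seq (sc i).1 | i <- enum 'I_r]).
have uS : uniq S by exact: undup_uniq.
have k0S : k0 \in S by rewrite mem_undup inE eqxx.
have scS i : {subset (sc i).1 <= S}.
  move=> k ki; rewrite mem_undup inE; apply/orP; right.
  by apply/flattenP; exists (sc i).1 => //; apply: map_f; rewrite mem_enum.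
have hS k : k \in S -> size k.1 = n /\ is_partition k.2.
  rewrite mem_undup inE => /predU1P[->|/flattenP[s /mapP[i _ ->] ki]]; first by [].
  exact: (hsc i).1.
pose c i k := (sc i).2 k.
have gE i : g i = \sum_(k <- S) cst (c i k) * xe k by apply: (hsc i).2.
pose de (k : seq nat * seq nat) : F := (k == k0)%:R.
have comb (b : 'I_r -> F) : \sum_(i < r) cst (b i) * g i =
    \sum_(k <- S) cst (\sum_i b i * c i k) * xe k.
  apply: (etrans _ (sum_comb cstM S b c xe)); apply: eq_bigr => i _.
  exact: (congr1 (fun p => cst (b i) * p) (gE i)).
have laE : \sum_(k <- S) cst (de k) * xe k = xsh xv 0 la.
  by apply: (etrans (sum_delta cstM xe uS k0S)); exact: xe_nil.
pose good d w := (d == sumn la) && (w < N2 la)%N.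
(* Beyond M the convergence identity holds and m exceeds every part of every rho in S, as
   [triangular] requires. *)
pose M := (M0 + \sum_(k <- S) sumn k.2)%N.
(* Contrapositive of [triangular] for E_{la 0^m} - x^la; the delta [de] accounts for the leading
   monomial. *)
have key m k : (M <= m)%N -> k \in S ->
    ~~ good (sumn k.1 + sumn k.2)%N (N2 k.1 + wt k.2)%N ->
    \sum_i a i m * c i k = de k.
  move=> Mm kS; apply: contraNeq; rewrite -subr_eq0.
  apply: (@triangular n m S (fun k => \sum_i a i m * c i k - de k) good) => //.
  - move=> k' k'S; have [h1 h2] := hS k' k'S; split=> //.
    apply/allP => j jk; apply: (@leq_trans (sumn k'.2)).
      by have := perm_sumn (perm_to_rem jk) => /= ->; exact: leq_addr.
    apply: leq_trans Mm; rewrite /M (bigD1_seq k') //=.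
    by rewrite addnCA leq_addr.
  - by move=> d w w' h /andP[hd hw]; rewrite /good hd (leq_ltn_trans h hw).
  move=> ga mo sga hmo.
  pose nu := la ++ nseq m 0%N.
  have snu : size nu = (n + m)%N by rewrite size_cat size_nseq.
  have -> : realizeM n (n + m) (\sum_(k <- S) cst (\sum_i a i m * c i k - de k) * xe k)
      = E nu - xsh xv 0 nu.
    have -> : \sum_(k <- S) cst (\sum_i a i m * c i k - de k) * xe k =
        \sum_(i < r) cst (a i m) * g i - xsh xv 0 la.
      apply: (etrans (sum_subr cstM S (fun k => \sum_i a i m * c i k) de xe)).
      exact: (f_equal2 (fun p q => p - q) (esym (comb (fun i => a i m))) laE).
    apply: (etrans (rmorphB (realizeM n (n + m)) _ _)).
    apply: (f_equal2 (fun p q => p - q)); last by rewrite realizeM_xsh xsh_pad.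
    apply: (etrans (realizeM_sum n (n + m) _ (fun i => a i m) g)).
    apply: esym; apply: etrans (hM m (leq_trans (leq_addr _ _) Mm)) _.
    exact: scale_sum.
  move/(nsMac_coef (hE nu) (sorted_geq_cat0 m pla) (etrans sga (esym snu)) hmo).
  rewrite sumn_cat sumn_nseq0 N2_cat N2_nseq0 !addn0 => -[-> h].
  by rewrite /good eqxx h.
have lim k : k \in S -> ~~ good (sumn k.1 + sumn k.2)%N (N2 k.1 + wt k.2)%N ->
    \sum_i al i * c i k = de k.
  by move=> kS bad; apply: (tconv_lin (M := M) ha) => m Mm; apply: key.
exists (\sum_(k <- S) cst (\sum_i al i * c i k - de k) * xe k).
  rewrite big_seq; apply: Fspan_sum => k kS.
  have [/andP[/eqP h1 h2]|bad] := boolP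
      (good (sumn k.1 + sumn k.2)%N (N2 k.1 + wt k.2)%N).
    by apply: FspanZ; apply: Fspan_gen; have [? ?] := hS k kS.
  apply: (Fspan_eq (f' := 0)); last by left.
  by rewrite (lim k kS bad) subrr cst0; exact: mul0r.
rewrite scale_sum (comb al) -{1}laE.
apply: (etrans _ (sum_addr cstM S de (fun k => \sum_i al i * c i k - de k) xe)).
by apply: eq_bigr => k _; rewrite (addrC (de k)) subrK.
Qed.

(** * Spanning and freeness of the A_la *)

Section Basis.
Context (E Et : seq nat -> Pol).
Hypothesis hE : forall nu, is_nsMac nu (E nu).
Hypothesis hEt : forall la, is_partition la ->
  IWconv (size la) (fun m => E (la ++ nseq m 0%N)) (Et la).

Let A la := sigmaT (size la) (Et la).

Lemma Lam_elems rho : Lam (elems rho).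
Proof. by apply: Elam_Lam; exact: Fspan_gen. Qed.

Lemma A_form la : is_partition la -> exists2 f,
  Fspan (fun b => sumn b = sumn la /\ (N2 b < N2 la)%N) HL f & A la = HL la + f.
Proof.
move=> pla; have [f hf Ef] := limit_form hE pla (hEt pla).
have [SD SZ] := sigmaT_lin (size la).
exists (sigmaT (size la) f); last first.
  rewrite /A Ef SD; apply: (f_equal2 (fun p q => p + q)) => //.
  by rewrite -(mulr1 (xsh xv 0 la)); apply: sigmaT_xsh Lam1.
apply: Fspan_map (sigmaT_lin _) _ hf => -[al rho] [/= h1 h2 h3 h4].
apply: (Fspan_eq (sigmaT_xsh h1 (Lam_elems rho))).
apply: Fspan_map (Jings_lin al) _ (elems_span_HL rho) => b [M hb].
apply: (Fspan_eq (esym (Jings_cat al b 1))); apply: (@Fspan_gen _ _ HL (al ++ b)).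
rewrite sumn_cat (sumn_cs hb) h3 N2_cat; split=> //.
by apply: leq_ltn_trans h4; rewrite leq_add2l; exact: N2_cs hb.
Qed.

Lemma HL_span_A b : Fspan (fun la => is_partition la /\ sumn la = sumn b) A (HL b).
Proof.
have [N] := ubnP (N2 b); elim: N b => // N IH b bN.
apply: Fspan_sub (straighten b) => ka [sk sumk Nk].
have [la [r [pla Eka]]] := sorted_strip sk.
have sumla : sumn la = sumn b by rewrite -sumk Eka sumn_cat sumn_nseq0 addn0.
have Nla : (N2 la <= N2 b)%N.
  by rewrite (leq_trans _ Nk) // Eka N2_cat N2_nseq0 addn0.
have [f hf Ef] := A_form pla.
(* The correction f involves only N2 < N2 la <= N2 b, where the induction hypothesis applies. *)
have -> : HL ka = A la - f by rewrite Eka HL_cat0 Ef addrK.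
apply: FspanB; first by apply: Fspan_gen.
apply: Fspan_sub hf => b' [s' N'].
apply: Fspan_imp (IH b' _) => [mu [h1 h2]|]; first by rewrite h2 s' sumla.
exact: leq_trans N' (leq_trans Nla bN).
Qed.

Lemma elems_span_A rho :
  Fspan (fun la => is_partition la /\ sumn la = sumn rho) A (elems rho).
Proof.
apply: Fspan_sub (elems_span_HL rho) => b [M hb].
by rewrite -(sumn_cs hb); exact: HL_span_A.
Qed.

Lemma A_span_elems la : is_partition la ->
  Fspan (fun rho => is_partition rho /\ sumn rho = sumn la) elems (A la).
Proof.
move=> pla; have HLe b : Fspan (fun rho => is_partition rho /\ sumn rho = sumn b)
    elems (HL b).
  apply: Fspan_sub (HL_span_elems b) => rho <-.
  have [rho' [h1 h2 ->]] := elems_norm rho.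
  exact: Fspan_gen.
have [f hf ->] := A_form pla; apply: FspanD; first exact: HLe.
by apply: Fspan_sub hf => b [<- _]; exact: HLe.
Qed.

Fixpoint seqs n D : seq (seq nat) :=
  if n is n'.+1 then [::] :: [seq x :: s | x <- iota 0 D.+1, s <- seqs n' D]
  else [:: [::]].

Lemma mem_seqs n D s : (size s <= n)%N -> all (fun x => x <= D)%N s -> s \in seqs n D.
Proof.
elim: n s => [|n IH] [|x s] // sn /andP[xD sD].
have h : x :: s \in [seq y :: w | y <- iota 0 D.+1, w <- seqs n D].
  by apply/allpairsP; exists (x, s); rewrite mem_iota add0n ltnS xD IH.
by rewrite -[seqs n.+1 D]/([::] :: _) in_cons h orbT.
Qed.

(** All sizes up to D are kept together: any finite relation lies in one such family, with no
    splitting into homogeneous components. *)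
Definition parts D : seq (seq nat) :=
  [seq s <- undup (seqs D D) | is_partition s && (sumn s <= D)%N].

Lemma parts_uniq D : uniq (parts D).
Proof. by rewrite filter_uniq // undup_uniq. Qed.

Lemma mem_parts D s : (s \in parts D) = is_partition s && (sumn s <= D)%N.
Proof.
rewrite mem_filter mem_undup andb_idr // => /andP[/andP[_ ps] sD].
apply: mem_seqs.
  apply: leq_trans sD; elim: s ps => //= x s IH /andP[x0 /IH h]; lia.
apply/allP => x xs; apply: leq_trans sD.
by have := perm_sumn (perm_to_rem xs) => /= ->; exact: leq_addr.
Qed.

Lemma elems_free D (c : seq nat -> F) :
  \sum_(x <- parts D) cst (c x) * elems x = 0 -> forall x, x \in parts D -> c x = 0.
Proof.
move=> h x xP; apply/eqP/negPn/negP => cx.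
pose S := [seq ([::], y) : seq nat * seq nat | y <- parts D].
have xS : ([::], x) \in S by apply: map_f.
have h0 : \sum_(k <- S) cst (c k.2) * xe k = 0.
  rewrite big_map -[RHS]h; apply: eq_bigr => y _.
  by congr (_ * _); exact: mul1r.
suff : false by [].
(* With [good] constantly false, a key with nonzero coefficient is a contradiction; D variables
   suffice since all parts are at most D. *)
apply: (@triangular 0 D S (fun k => c k.2) (fun _ _ => false) _ _ _ _ _ xS cx) => //.
- by rewrite map_inj_uniq ?parts_uniq // => y z [].
- move=> k /mapP[y yP ->]; rewrite mem_parts in yP.
  have [py sy] := andP yP; split=> //=; apply/allP => j jy; apply: leq_trans sy.
  by have := perm_sumn (perm_to_rem jy) => /= ->; exact: leq_addr.
by move=> ga m _ _; rewrite h0 (rmorph0 (realizeM 0 _)) mcoeff0 eqxx.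
Qed.

Lemma A_free D (c : seq nat -> F) :
  \sum_(x <- parts D) cst (c x) * A x = 0 -> forall x, x \in parts D -> c x = 0.
Proof.
apply: (free_transfer_seq (parts_uniq D) (@elems_free D)) => x;
  rewrite mem_parts => /andP[px sx].
  apply: Fspan_imp (elems_span_A x) => y [py sy].
  by rewrite mem_parts py sy.
apply: Fspan_imp (A_span_elems px) => y [py sy].
by rewrite mem_parts py sy.
Qed.

Lemma A_basis : is_basis_Lambda A.
Proof.
split; [|split].
- move=> la pla; apply/Lam_inLambda/Elam_Lam.
  by apply: Fspan_imp (A_span_elems pla).
- move=> S c hS h la laS.
  pose D := (\sum_(x <- S) sumn x)%N.
  have SP : {subset enum_fset S <= parts D}.
    move=> x xS; rewrite mem_parts hS //= /D.
    by rewrite (bigD1_seq x) ?fset_uniq //= leq_addr.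
  have : \sum_(x <- parts D) cst (if x \in enum_fset S then c x else 0) * A x = 0.
    apply: (etrans (sum_restrict cstM c A (fset_uniq S) (parts_uniq D) SP)).
    by rewrite -[RHS]h; apply: eq_bigr => x _; exact: esym (Pol_scale _ _).
  by move/A_free/(_ la (SP _ laS)); rewrite laS.
move=> f /inLambda_Elam hf.
have /Fspan_list[[s c] /= [hs hc]] : Fspan (fun la => is_partition la) A f.
  apply: Fspan_sub hf => rho _.
  by apply: Fspan_imp (elems_span_A rho) => la [].
exists [fset x in s]%fset, c; split=> [la|]; first by rewrite inE; apply: hs.
have sub : {subset s <= enum_fset [fset x in s]%fset} by move=> x xs; rewrite inE.
apply: (etrans (hc _ (fset_uniq _) sub)).
by apply: eq_bigr => x _; exact: esym (Pol_scale _ _).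
Qed.

End Basis.

(* E nu   = the non-symmetric Macdonald polynomial E_nu (nu in Z^N_{>=0}, N = size nu);
   Et la  = tilde E_la in P(l(la))^+, the Ion--Wu limit of E_{la * 0^m};
   A_la   = sigma~(tilde E_la).  Claim: {A_la} is a basis of Lambda. *)
Theorem theorem6 (E Et : seq nat -> Pol)
  (hE : forall nu : seq nat, is_nsMac nu (E nu))
  (hEt : forall la : seq nat, is_partition la ->
           IWconv (size la) (fun m => E (la ++ nseq m 0%N)) (Et la)) :
  is_basis_Lambda (fun la => sigmaT (size la) (Et la)).
Proof. exact: (A_basis hE hEt). Qed.
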